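(* Let $A,B$ be $n\times n$ complex hermitian matrices and let $k\in\{1,\ldots,n-1\}$. Let $i_1,\ldots,i_k$ be integers with $1\le i_1<\cdots<i_k\le n$. Then $$\sum_{j=1}^k \lambda_{i_j}(A+B)\le\sum_{j=1}^k \lambda_{i_j}(A) + \sum_{j=1}^k \lambda_j(B).$$ Moreover, equality $$\sum_{j=1}^k \lambda_{i_j}(A+B)=\sum_{j=1}^k \lambda_{i_j}(A) + \sum_{j=1}^k \lambda_j(B)$$ holds if and only if the following condition is satisfied: there exist a positive integer $r$, subspaces $\mathbf{U}_1,\ldots,\mathbf{U}_r\subset\mathbb{C}^n$, each invariant under both $A$ and $B$, and real numbers $0=b_0<b_1<\cdots<b_{r-1}<b_r=1$ such that (i) for each $l\in\{1,\ldots,r\}$, $\mathbf{U}_l$ is spanned by $k$ orthonormal eigenvectors of $B$ corresponding to $\lambda_1(B),\ldots,\lambda_k(B)$ (i.e. $\mathbf{U}_l$ has an orthonormal basis $\mathbf{x}_1,\ldots,\mathbf{x}_k$ with $B\mathbf{x}_j=\lambda_j(B)\mathbf{x}_j$ for $j=1,\ldots,k$); (ii) for each $l\in\{1,\ldots,r\}$, if $\mu_{1,l}(t)\ge\cdots\ge\mu_{k,l}(t)$ denote the eigenvalues, counted with multiplicity, of the restriction of $A(t)=A+tB$ to $\mathbf{U}_l$, then $\mu_{j,l}(t)=\lambda_{i_j}(t)$ for all $j\in\{1,\ldots,k\}$ and all $t\in[b_{l-1},b_l]$.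
   Context: For an $n\times n$ hermitian matrix $C$, $\lambda_1(C)\ge\cdots\ge\lambda_n(C)$ denote its eigenvalues counted with multiplicity. For hermitian $A,B$ and $t\in\mathbb{R}$, $A(t):=A+tB$, and $\lambda_1(t)\ge\cdots\ge\lambda_n(t)$ denote the eigenvalues of $A(t)$ counted with multiplicity, i.e. $\lambda_i(t)=\lambda_i(A+tB)$. *)

(* Defs.v *)
From HB Require Import structures.
From mathcomp Require Import all_boot all_order all_algebra.
From mathcomp Require Import spectral.
From mathcomp Require Import reals.
From mathcomp Require Import complex.

Set Implicit Arguments.
Unset Strict Implicit.
Unset Printing Implicit Defensive.

Import Order.TTheory GRing.Theory Num.Theory.
Local Open Scope ring_scope.
Local Open Scope complex_scope.
Local Open Scope sesquilinear_scope.

(* The spectrum is listed in R; taking real parts of the roots of the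
   characteristic polynomial loses nothing for matrices with real spectrum, in
   particular for hermitian ones (char_poly_eigs) and for matrices of
   restrictions of hermitian endomorphisms to invariant subspaces. *)
Definition eigs (R : realType) (n : nat) (M : 'M[R[i]]_n) : seq R :=
  sort (fun x y => y <= x)
    [seq complex.Re z | z <- sval (closed_field_poly_normal (char_poly M))].

(* Indices start at 0: lambda M j is the (j+1)-st largest eigenvalue. *)
Definition lambda (R : realType) (n : nat) (M : 'M[R[i]]_n) (j : nat) : R :=
  nth 0 (eigs M) j.

Definition pencil (R : realType) (n : nat) (A B : 'M[R[i]]_n) (t : R) :
  'M[R[i]]_n := A + t%:C *: B.

Definition invariant_under (R : realType) (n : nat) (M : 'M[R[i]]_n)
  (U : {vspace 'cV[R[i]]_n}) : Prop :=
  forall x : 'cV[R[i]]_n, x \in U -> M *m x \in U.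

(* The restriction of x |-> M x to U. The projection vsproj only serves to land
   in the subtype of U; it is the identity on M U when U is M-invariant. *)
Definition restriction (R : realType) (n : nat) (M : 'M[R[i]]_n)
  (U : {vspace 'cV[R[i]]_n}) : 'End(subvs_of U) :=
  linfun (vsproj U \o mulmx M \o @vsval _ _ U).

(* The spectrum does not depend on the basis used to write the matrix. *)
Definition restriction_lambda (R : realType) (n : nat) (M : 'M[R[i]]_n)
  (U : {vspace 'cV[R[i]]_n}) (j : nat) : R :=
  let e := vbasis {:subvs_of U} in lambda (passmx.mxof e e (restriction M U)) j.

Definition orthonormal (R : realType) (n k : nat)
  (x : k.-tuple 'cV[R[i]]_n) : Prop :=
  forall a b : 'I_k,
    ((tnth x a) ^t* *m tnth x b) 0 0 = (a == b)%:R.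

Definition spanned_by_top_eigenvectors (R : realType) (n k : nat)
  (B : 'M[R[i]]_n) (U : {vspace 'cV[R[i]]_n}) : Prop :=
  exists x : k.-tuple 'cV[R[i]]_n,
    [/\ orthonormal x, basis_of U x &
        forall j : 'I_k, B *m tnth x j = (lambda B j)%:C *: tnth x j].

Lemma char_poly_roots (R : realType) (n : nat) (M : 'M[R[i]]_n) :
  char_poly M =
  \prod_(z <- sval (closed_field_poly_normal (char_poly M))) ('X - z%:P).
Proof.
case: closed_field_poly_normal => s /= {1}->.
by rewrite (monicP (char_poly_monic M)) scale1r.
Qed.

Lemma size_eigs (R : realType) (n : nat) (M : 'M[R[i]]_n) : size (eigs M) = n.
Proof.
rewrite size_sort size_map; apply: succn_inj.
by rewrite -(size_char_poly M) [in RHS]char_poly_roots size_prod_XsubC.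
Qed.

Lemma eigs_sorted (R : realType) (n : nat) (M : 'M[R[i]]_n) :
  sorted (fun x y => y <= x) (eigs M).
Proof. by apply: sort_sorted => x y; exact: le_total. Qed.

Lemma hermitian_root_real (R : realType) (n : nat) (M : 'M[R[i]]_n) (z : R[i]) :
  M \is hermsymmx -> root (char_poly M) z -> z = (complex.Re z)%:C.
Proof.
move=> hM; rewrite -eigenvalue_root_char => /eigenvalueP[v vM v0].
have [zR|] := boolP (z \is Num.real); first by rewrite RRe_real.
case/negP.
have hM' : M ^t* = M.
  by move/is_hermitianmxP: hM; rewrite expr0 scale1r => <-.
have nz : (v *m v ^t*) 0 0 != 0 by rewrite -dotmxE dnorm_eq0.
have e1 : (v *m M *m v ^t*) 0 0 = z * (v *m v ^t*) 0 0.
  by rewrite vM -scalemxAl mxE.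
have e2 : (v *m M *m v ^t*) 0 0 = z^* * (v *m v ^t*) 0 0.
  rewrite -{1}hM' -mulmxA -map_mxM -trmx_mul vM linearZ /= map_mxZ.
  by rewrite -scalemxAr mxE.
apply/CrealP; apply: (mulIf nz); by rewrite -e2 e1.
Qed.

Lemma char_poly_eigs (R : realType) (n : nat) (M : 'M[R[i]]_n) :
  M \is hermsymmx -> char_poly M = \prod_(x <- eigs M) ('X - (x%:C)%:P).
Proof.
move=> hM; rewrite (perm_big _ (permEl (perm_sort _ _))) /= big_map.
rewrite [LHS]char_poly_roots; apply: eq_big_seq => z zs.
rewrite -(hermitian_root_real hM) // char_poly_roots.
by rewrite root_prod_XsubC.
Qed.

Lemma restrictionE (R : realType) (n : nat) (M : 'M[R[i]]_n)
  (U : {vspace 'cV[R[i]]_n}) (u : subvs_of U) :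
  invariant_under M U -> vsval (restriction M U u) = M *m vsval u.
Proof. by move=> MU; rewrite lfunE /= vsprojK // MU // subvsP. Qed.

(* Main.v *)
Require Import Defs.
From mathcomp Require Import all_boot all_order all_algebra.
From mathcomp Require Import perm spectral zify lra.
From mathcomp Require Import reals.
From mathcomp Require Import complex.

Import Order.TTheory GRing.Theory Num.Theory.
Local Open Scope ring_scope.

(** Let [beta] be the [k]-th largest eigenvalue of [B], and write
    [B = beta + P - Q] with [P] and [Q] the positive and negative parts of
    [B - beta]. Then [S], the sum of the [k] largest eigenvalues of [B], is
    [k beta + tr P]. Following Li and Mathias, every eigenvalue of [A + P - Q]
    is at most that of [A + P], and the eigenvalues of [A] all increase when [P]
    is added, by [tr P] in total; this gives the inequality ([lidskii]).

    If equality holds for [A + B], it holds for [A + t B] at every [t] in [0, 1],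
    because the inequality also applies between [A + t B] and [A + B]. Equality
    in the two steps above then says that, for the selected indices, [A + t P]
    and [A + t P - t Q] have the same eigenvalues, and that, for the other
    indices, [A] and [A + t P] have the same eigenvalues ([lidskii_tight]). An
    eigenvalue that does not change when a positive matrix is added comes with
    common eigenvectors killed by that matrix, in the right number
    ([rank_eigenspace_cap]).

    These common eigenvectors are combined at one generic time [t]. Evaluating
    the rank of [A - c + z P] at [z = 'i], where its kernel consists of common
    eigenvectors, shows that for generic real [t] an eigenspace of [H = A + t P]
    that meets the kernel of [P] is contained in it ([generic_parameter]).
    Hence [H] has an orthonormal eigenbasis whose selected vectors are killed by
    [Q] and whose other vectors are killed by [P] ([exists_adapted_basis]). The
    span [U] of the selected vectors reduces [A] and [B], and its orthogonal
    complement carries eigenvalues of [A + t P] that do not depend on [t].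
    Cancelling the corresponding factor of the characteristic polynomial
    identifies the eigenvalues of [A + t B] on [U] for all [t] in [0, 1], so one
    subspace suffices ([reducing_subspace]) and the eigenvalue branches need not
    be followed through their crossings.

    Conversely, on each interval of the partition the sum of the selected
    eigenvalues is the trace of [A + t B] on an invariant subspace, which is
    affine in [t] with slope [S] ([sum_restriction_lambda]); the increments add
    up to [S]. *)

Section LidskiiWielandt.
Set Implicit Arguments.
Unset Strict Implicit.
Unset Printing Implicit Defensive.
Local Open Scope complex_scope.
Local Open Scope sesquilinear_scope.

Variable R : realType.
Local Notation C := R[i].

(** * Ordered eigenvalues of hermitian matrices *)

Lemma hermsymP n (M : 'M[C]_n) : reflect (M = M ^t*) (M \is hermsymmx).
Proof.
by apply: (iffP (is_hermitianmxP _ _ _)); rewrite expr0 scale1r.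
Qed.

Lemma ge_trans_R : transitive (fun x y : R => y <= x).
Proof. by move=> y x z yx zy; exact: le_trans zy yx. Qed.

Lemma ge_anti_R : antisymmetric (fun x y : R => y <= x).
Proof. by move=> x y /andP[yx xy]; apply/le_anti; rewrite xy yx. Qed.

(** The list of eigenvalues is the only non-increasing list of reals that
    splits the characteristic polynomial. *)
Lemma eigs_unique n (M : 'M[C]_n) (s : seq R) :
  sorted (fun x y => y <= x) s ->
  char_poly M = \prod_(x <- s) ('X - (x%:C)%:P) -> eigs M = s.
Proof.
move=> ss; rewrite [char_poly M]char_poly_roots.
have -> : \prod_(x <- s) ('X - (x%:C)%:P) =
          \prod_(z <- map (fun x : R => x%:C) s) ('X - z%:P) by rewrite big_map.
move=> /prod_XsubC_eq /(perm_map (@complex.Re R)).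
rewrite -map_comp (@eq_map _ _ _ id) // map_id => e.
apply: (sorted_eq ge_trans_R ge_anti_R (eigs_sorted M) ss).
by rewrite (perm_trans _ e) // perm_sort.
Qed.

(** The same with the eigenvalues given as a function, whose index type may
    differ from the dimension of the matrix. *)
Lemma lambda_unique n (M : 'M[C]_n) p (d : 'I_p -> R) :
  (forall a b : 'I_p, (a <= b)%N -> d b <= d a) ->
  char_poly M = \prod_j ('X - ((d j)%:C)%:P) ->
  forall j : 'I_p, lambda M j = d j.
Proof.
move=> dn e j.
have /eigs_unique eM : sorted (fun x y => y <= x) [seq d j | j <- enum 'I_p].
  rewrite sorted_map.
  have := iota_sorted 0 p; rewrite -val_enum_ord sorted_map.
  by apply: sub_sorted => a b; exact: dn.
rewrite /lambda eM; last by rewrite big_map big_enum.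
by rewrite (nth_map j) ?size_enum_ord // nth_ord_enum.
Qed.

Lemma lambda_mono n (M : 'M[C]_n) (a b : nat) :
  (a <= b)%N -> (b < n)%N -> lambda M b <= lambda M a.
Proof.
move=> ab bn; apply: (sorted_leq_nth ge_trans_R _ 0 (eigs_sorted M)) => //;
  rewrite ?inE ?size_eigs //; exact: leq_ltn_trans bn.
Qed.

(** [S] and [T] are mutually inverse; the formats [(p, n)] and [(n, p)] leave
    the equality of [p] and [n] as a consequence, so that no casts arise when
    [p] is a sum. *)
Lemma char_poly_conj (F : fieldType) p n (S : 'M[F]_(p, n)) (T : 'M[F]_(n, p))
    (M : 'M[F]_n) :
  S *m T = 1%:M -> T *m S = 1%:M -> char_poly (S *m M *m T) = char_poly M.
Proof.
move=> ST TS.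
have epn : p = n.
  apply/eqP; rewrite eqn_leq.
  by rewrite (mulmx1_min ST) (mulmx1_min TS).
case: n / epn S T M ST TS => S T M ST TS.
rewrite /char_poly /char_poly_mx.
have e : map_mx polyC S *m map_mx polyC T = 1%:M by rewrite -map_mxM ST map_mx1.
have -> : 'X%:M - map_mx polyC (S *m M *m T) =
  map_mx polyC S *m ('X%:M - map_mx polyC M) *m map_mx polyC T.
  rewrite mulmxBr mulmxBl scalar_mxC !map_mxM; congr (_ - _).
  by rewrite -mulmxA e mulmx1.
by rewrite !det_mulmx mulrAC -det_mulmx e det1 mul1r.
Qed.

Lemma char_poly_diag n (M S : 'M[C]_n) (d : 'rV[C]_n) : S \is unitarymx ->
  S *m M = diag_mx d *m S -> char_poly M = \prod_j ('X - (d 0 j)%:P).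
Proof.
move=> uS SM; have SS : S *m S ^t* = 1%:M by exact/unitarymxP.
rewrite -(char_poly_conj M SS (mulmx1C SS)) SM -mulmxA SS mulmx1.
rewrite char_poly_trig ?diag_mx_is_trig //.
by apply: eq_bigr => j _; rewrite !mxE eqxx.
Qed.

(** The spectral theorem, with the eigenvalues in non-increasing order: the
    rows of [S] are an orthonormal family of left eigenvectors. *)
Lemma spectral_sorted n (M : 'M[C]_n) : M \is hermsymmx ->
  exists2 S : 'M[C]_n, S \is unitarymx &
    S *m M = diag_mx (\row_j (lambda M j)%:C) *m S.
Proof.
move=> hM.
have /orthomx_spectralP eM : M \is normalmx by exact: hermitian_normalmx.
set S0 := spectralmx M in eM; set d0 := spectral_diag M in eM.
have uS0 : S0 \is unitarymx by exact: spectral_unitarymx.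
have S0u : S0 \in unitmx by exact: unitarymx_unit.
clearbody S0 d0.
have SM : S0 *m M = diag_mx d0 *m S0.
  by rewrite eM -!mulmxA (mulKVmx S0u).
have chM := char_poly_diag uS0 SM.
have : perm_eq [tuple (lambda M j)%:C | j < n] [tuple d0 0 j | j < n].
  apply: prod_XsubC_eq; rewrite !big_tuple.
  under eq_bigr do rewrite tnth_mktuple.
  under [RHS]eq_bigr do rewrite tnth_mktuple.
  rewrite -chM (char_poly_eigs hM) (big_nth 0) size_eigs big_mkord.
  exact: eq_bigr.
move=> /tuple_permP[s es].
have {es} e (j : 'I_n) : (lambda M j)%:C = d0 0 (s j).
  have /(congr1 (fun t => tnth t j)) := val_inj es.
  by rewrite !tnth_mktuple.
exists (row_perm s S0).
  apply/unitarymxP; apply/matrixP => i j.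
  move/unitarymxP/matrixP: uS0 => /(_ (s i) (s j)).
  rewrite !mxE (inj_eq perm_inj) => <-.
  by apply: eq_bigr => l _; rewrite !mxE.
apply/matrixP => i j; move/matrixP: SM => /(_ (s i) j).
rewrite !mul_diag_mx !mxE -e => <-.
by apply: eq_bigr => l _; rewrite !mxE.
Qed.

Lemma lambda_diag n (M S : 'M[C]_n) (d : 'I_n -> R) : S \is unitarymx ->
  S *m M = diag_mx (\row_j (d j)%:C) *m S ->
  (forall a b : 'I_n, (a <= b)%N -> d b <= d a) ->
  forall j : 'I_n, lambda M j = d j.
Proof.
move=> uS SM dn; apply: lambda_unique => //.
by rewrite (char_poly_diag uS SM); apply: eq_bigr => j _; rewrite mxE.
Qed.

Lemma lambda_shift n (M : 'M[C]_n) (a : R) (j : 'I_n) : M \is hermsymmx ->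
  lambda (M + (a%:C)%:M) j = lambda M j + a.
Proof.
move=> hM; have [S uS SM] := spectral_sorted hM.
apply: (@lambda_diag _ _ S (fun j => lambda M j + a)) => //; last first.
  by move=> b c bc; rewrite lerD2r lambda_mono.
rewrite mulmxDr SM scalar_mxC -mulmxDl; congr (_ *m S).
by apply/matrixP => b c; rewrite !mxE rmorphD /= -mulrnDl.
Qed.

Lemma lambda_trace n (M : 'M[C]_n) : M \is hermsymmx ->
  \sum_(j < n) (lambda M j)%:C = \tr M.
Proof.
move=> hM; have [S uS SM] := spectral_sorted hM.
have SS : S *m S ^t* = 1%:M by exact/unitarymxP.
have -> : \tr M = \tr (S ^t* *m (S *m M)) by rewrite mulmxA (mulmx1C SS) mul1mx.
rewrite SM mxtrace_mulC -mulmxA SS mulmx1 mxtrace_diag.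
by apply: eq_bigr => j _; rewrite mxE.
Qed.

(** * Hermitian forms *)

(** The value at the row vector [x] of the hermitian form of [M]. *)
Definition qform n (M : 'M[C]_n) (x : 'rV[C]_n) : C := (x *m M *m x ^t*) 0 0.

(** Positive semidefinite hermitian matrices. *)
Definition psd n (P : 'M[C]_n) :=
  P \is hermsymmx /\ forall x, 0 <= qform P x.

Lemma qform_spectral n (M S : 'M[C]_n) (d : 'I_n -> R) x : S \is unitarymx ->
  S *m M = diag_mx (\row_j (d j)%:C) *m S ->
  qform M x = \sum_j (d j)%:C * `|(x *m S ^t*) 0 j| ^+ 2.
Proof.
move=> uS SM; have SS : S *m S ^t* = 1%:M by exact/unitarymxP.
have xE : x = x *m S ^t* *m S by rewrite -mulmxA (mulmx1C SS) mulmx1.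
set y := x *m S ^t* in xE *.
have xaE : x ^t* = S ^t* *m y ^t* by rewrite xE trmx_mul map_mxM.
rewrite /qform xaE {1}xE -(mulmxA y) SM !mulmxA -(mulmxA _ S) SS mulmx1.
rewrite mxE; apply: eq_bigr => j _.
by rewrite mul_mx_diag !mxE mulrAC mulrC normCK.
Qed.

Lemma qform_norm n (S : 'M[C]_n) (x : 'rV[C]_n) : S \is unitarymx ->
  (x *m x ^t*) 0 0 = \sum_j `|(x *m S ^t*) 0 j| ^+ 2.
Proof.
move=> uS; have <- : qform 1%:M x = (x *m x ^t*) 0 0 by rewrite /qform mulmx1.
rewrite (@qform_spectral _ _ S (fun=> 1)) //.
  by apply: eq_bigr => j _; rewrite mul1r.
rewrite scalar_mxC; congr (_ *m _).
by apply/matrixP => i j; rewrite !mxE.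
Qed.

(** If the components of [x] along the eigenvectors with eigenvalue below [c]
    vanish, the Rayleigh quotient of [x] is at least [c], and when it equals
    [c] the vector [x] is itself an eigenvector. *)
Lemma qform_ge n (M S : 'M[C]_n) (d : 'I_n -> R) (c : R) (x : 'rV[C]_n) : S \is unitarymx ->
  S *m M = diag_mx (\row_j (d j)%:C) *m S ->
  (forall j, d j < c -> (x *m S ^t*) 0 j = 0) ->
  c%:C * (x *m x ^t*) 0 0 <= qform M x /\
  (qform M x <= c%:C * (x *m x ^t*) 0 0 -> x *m M = c%:C *: x).
Proof.
move=> uS SM y0; have SS : S *m S ^t* = 1%:M by exact/unitarymxP.
rewrite (qform_spectral x uS SM) (qform_norm x uS) mulr_sumr.
have le j : c%:C * `|(x *m S ^t*) 0 j| ^+ 2 <= (d j)%:C * `|(x *m S ^t*) 0 j| ^+ 2.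
  have [/y0 ->|cd] := ltP (d j) c; first by rewrite normr0 expr0n !mulr0.
  by rewrite ler_wpM2r ?exprn_ge0 // lecR.
split; first exact: ler_sum.
move=> ge.
have e j : c%:C * (x *m S ^t*) 0 j = (d j)%:C * (x *m S ^t*) 0 j.
  have : c%:C * `|(x *m S ^t*) 0 j| ^+ 2 = (d j)%:C * `|(x *m S ^t*) 0 j| ^+ 2.
    apply/eqP; rewrite -subr_eq0 -oppr_eq0 opprB; apply/eqP.
    have h0 i : true -> 0 <= (d i)%:C * `|(x *m S ^t*) 0 i| ^+ 2 -
       c%:C * `|(x *m S ^t*) 0 i| ^+ 2 by rewrite subr_ge0 le.
    apply: (psumr_eq0P (P := xpredT) h0 _ (i := j)) => //.
    by apply/le_anti; rewrite sumr_ge0 // andbT sumrB subr_le0.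
  move/eqP; rewrite -subr_eq0 -mulrBl mulf_eq0 sqrf_eq0 normr_eq0.
  by case/orP => [|/eqP ->]; rewrite ?mulr0 // subr_eq0 => /eqP ->.
have xE : x = x *m S ^t* *m S by rewrite -mulmxA (mulmx1C SS) mulmx1.
rewrite {1}xE -mulmxA SM mulmxA [in RHS]xE scalemxAl; congr (_ *m _).
by apply/rowP => j; rewrite mul_mx_diag [LHS]mxE [RHS]mxE e mulrC [in LHS]mxE.
Qed.

Lemma qform_le n (M S : 'M[C]_n) (d : 'I_n -> R) (c : R) (x : 'rV[C]_n) : S \is unitarymx ->
  S *m M = diag_mx (\row_j (d j)%:C) *m S ->
  (forall j, c < d j -> (x *m S ^t*) 0 j = 0) ->
  qform M x <= c%:C * (x *m x ^t*) 0 0.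
Proof.
move=> uS SM y0.
rewrite (qform_spectral x uS SM) (qform_norm x uS) mulr_sumr.
apply: ler_sum => j _.
have [/y0 ->|cd] := ltP c (d j); first by rewrite normr0 expr0n !mulr0.
by rewrite ler_wpM2r ?exprn_ge0 // lecR.
Qed.

Lemma psd_lambda_ge0 n (P : 'M[C]_n) (j : 'I_n) : psd P -> 0 <= lambda P j.
Proof.
move=> [hP P0]; have [S uS SP] := spectral_sorted hP.
have := P0 (row j S); rewrite (qform_spectral _ uS SP) -row_mul.
have /unitarymxP -> := uS.
rewrite (bigD1 j) //= big1 => [|i ij]; last by rewrite !mxE eq_sym (negPf ij) normr0 expr0n mulr0.
by rewrite !mxE eqxx normr1 expr1n mulr1 addr0 lecR.
Qed.

Lemma psd_ker n (P : 'M[C]_n) x : psd P -> qform P x = 0 -> x *m P = 0.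
Proof.
move=> pP q0; have [hP P0] := pP; have [S uS SP] := spectral_sorted hP.
have [|_] := @qform_ge _ P S _ 0 x uS SP.
  by move=> j; rewrite ltNge psd_lambda_ge0.
by rewrite q0 !mul0r scale0r; apply.
Qed.

(** * Monotonicity of eigenvalues and its equality case *)

Lemma mxrank_nonzero_rows (F : fieldType) m n (M : 'M[F]_(m, n)) (p : pred 'I_m) :
  (forall i, ~~ p i -> row i M = 0) -> (\rank M <= #|p|)%N.
Proof.
move=> z.
have /mxrankS/leq_trans : (M <= \sum_(i | p i) <<row i M>>)%MS.
  apply/row_subP => i; have [pi|/z ->] := boolP (p i); last exact: sub0mx.
  by rewrite (sumsmx_sup i) // genmxE.
apply; apply: leq_trans (mxrank_sum_leqif _) _.
rewrite /= -sum1_card; apply: leq_sum => i _.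
by rewrite genmxE rank_leq_row.
Qed.

(** Prescribing zeros for the coordinates in [p] costs at most [#|p|]
    dimensions. *)
Lemma kermx_coords (F : fieldType) n (T : 'M[F]_n) (p : pred 'I_n) :
  exists2 W : 'M[F]_n, (n <= \rank W + #|p|)%N &
    forall x : 'rV_n, (x <= W)%MS -> forall j, p j -> (x *m T) 0 j = 0.
Proof.
pose Z : 'M[F]_n := \matrix_(i, j) if p j then T i j else 0.
exists (kermx Z).
  have : (\rank Z^T <= #|p|)%N.
    apply: mxrank_nonzero_rows => i /negPf pi.
    by apply/rowP => j; rewrite !mxE pi.
  rewrite mxrank_ker mxrank_tr; lia.
move=> x /sub_kermxP /rowP xZ j pj; have := xZ j.
rewrite mxE [RHS]mxE => e; rewrite mxE -[RHS]e.
by apply: eq_bigr => i _; rewrite !mxE pj.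
Qed.

Lemma kermx_coords2 (F : fieldType) n (S T : 'M[F]_n) (p q : pred 'I_n) :
  exists2 W : 'M[F]_n, (n <= \rank W + #|p| + #|q|)%N &
    forall x : 'rV_n, (x <= W)%MS ->
      (forall j, p j -> (x *m S) 0 j = 0) /\ (forall j, q j -> (x *m T) 0 j = 0).
Proof.
have [V rV Vp] := kermx_coords S p; have [W rW Wq] := kermx_coords T q.
exists (V :&: W)%MS => [|x].
  have := mxrank_sum_cap V W; have := rank_leq_col (V + W)%MS; lia.
by rewrite sub_capmx => /andP[/Vp ? /Wq].
Qed.

(** Monotonicity of each eigenvalue for the Loewner order (Weyl). *)
Lemma lambda_le n (L K : 'M[C]_n) (j : 'I_n) :
  L \is hermsymmx -> K \is hermsymmx -> (forall x, qform L x <= qform K x) ->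
  lambda L j <= lambda K j.
Proof.
move=> hL hK LK; have [S uS SL] := spectral_sorted hL.
have [T uT TK] := spectral_sorted hK.
(* A nonzero [x] in the span of the first [j + 1] eigenvectors of [L] and in
   that of the last [n - j] eigenvectors of [K] compares the two eigenvalues. *)
pose p : pred 'I_n := fun i => (j < i)%N.
pose q : pred 'I_n := fun i => (i < j)%N.
have [W rW WP] := kermx_coords2 (S ^t*) (T ^t*) p q.
have W0 : (0 < \rank W)%N.
  have : (#|p| + #|q| < n)%N.
    rewrite -[X in (_ < X)%N]card_ord -(cardC (pred1 j)) card1 add1n ltnS.
    rewrite -cardUI [X in (_ + X)%N]eq_card0 => [|i]; last first.
      by rewrite !inE /= !unfold_in /p /q; case: ltngtP.
    rewrite addn0; apply: subset_leq_card; apply/subsetP => i.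
    by rewrite !inE -val_eqE !unfold_in /p /q; case: ltngtP.
  move: rW; lia.
have /rowV0Pn[x xW xn0] : W != 0 by rewrite -mxrank_eq0 -lt0n.
have [xp xq] := WP x xW.
have x2 : 0 < (x *m x ^t*) 0 0 by rewrite -dotmxE dnorm_gt0.
have le1 : (lambda L j)%:C * (x *m x ^t*) 0 0 <= qform L x.
  apply: (qform_ge uS SL _).1 => i lt; apply: xp; rewrite /p.
  by rewrite ltnNge; apply: contraTN lt => ij; rewrite -leNgt lambda_mono.
have le2 : qform K x <= (lambda K j)%:C * (x *m x ^t*) 0 0.
  apply: (qform_le uT TK) => i lt; apply: xq; rewrite /q.
  by rewrite ltnNge; apply: contraTN lt => ij; rewrite -leNgt lambda_mono.
have := le_trans le1 (le_trans (LK x) le2).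
by rewrite (ler_pM2r x2) lecR.
Qed.

Lemma card_disjoint3 n (p q r : pred 'I_n) :
  (forall j, p j + q j + r j <= 1)%N -> (#|p| + #|q| + #|r| <= n)%N.
Proof.
move=> h; have cE (s : pred 'I_n) : #|s| = (\sum_j s j)%N.
  by rewrite -sum1_card big_mkcond; apply: eq_bigr => j _; rewrite unfold_in; case: (s j).
rewrite !cE -!big_split /= -[X in (_ <= X)%N]card_ord -sum1_card.
exact: leq_sum.
Qed.

Lemma lt_eq_lt_count (a b c : R) : ~~ ((a < c) && (c < b)) ->
  (((a == c) && (b == c)) + (a < c)%R + (c < b)%R <= 1)%N.
Proof. by case: (ltgtP a c) => _; case: (ltgtP b c) => _. Qed.

(** The equality case of monotonicity: every index at which the eigenvalue [c]
    is unchanged by adding [P] contributes a dimension of common eigenvectors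
    of [L] killed by [P]. *)
Lemma rank_eigenspace_cap n (L P : 'M[C]_n) (c : R) :
  L \is hermsymmx -> psd P ->
  (#|[pred j : 'I_n | (lambda L j == c) && (lambda (L + P)%R j == c)]|
     <= \rank (eigenspace L c%:C :&: kermx P)%MS)%N.
Proof.
move=> hL pP; have [hP P0] := pP.
have hK : L + P \is hermsymmx.
  by apply/hermsymP; rewrite linearD /= map_mxD -(hermsymP _ hL) -(hermsymP _ hP).
have [S uS SL] := spectral_sorted hL.
have [T uT TK] := spectral_sorted hK.
set J := (X in (#|X| <= _)%N).
pose p : pred 'I_n := fun i => lambda L i < c.
pose q : pred 'I_n := fun i => c < lambda (L + P) i.
have [W rW WP] := kermx_coords2 (S ^t*) (T ^t*) p q.
have WE : (W <= eigenspace L c%:C :&: kermx P)%MS.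
  apply/rV_subP => x /WP[xp xq].
  have [le1 eq1] := qform_ge uS SL xp.
  have le2 := qform_le uT TK xq.
  have e : qform (L + P) x = qform L x + qform P x.
    by rewrite /qform mulmxDr mulmxDl mxE.
  have xP : x *m P = 0.
    apply: psd_ker => //; apply/le_anti; rewrite P0 andbT.
    by rewrite -(lerD2l (qform L x)) -e addr0 (le_trans le2).
  rewrite sub_capmx; apply/andP; split; last by apply/sub_kermxP.
  apply/eigenspaceP; apply: eq1; apply: le_trans le2.
  by rewrite e lerDl P0.
apply: leq_trans (mxrankS WE).
have [j0 /= /andP[/eqP Lj0 /eqP Kj0]|J0] := pickP J; last by rewrite eq_card0.
(* An index in [p] and [q] at once would have to lie both after and before
   [j0], so the three sets are disjoint. *)
suff : (#|J| + #|p| + #|q| <= n)%N by move: rW; lia.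
apply: (@card_disjoint3 _ J) => j; apply: lt_eq_lt_count; apply/andP => -[Lj Kj].
have [jj|jj] := leqP j j0.
  by have := lambda_mono L jj (ltn_ord _); rewrite Lj0 leNgt Lj.
by have := lambda_mono (L + P) (ltnW jj) (ltn_ord _); rewrite Kj0 leNgt Kj.
Qed.

(** * Positive and negative parts, and the inequality *)

Lemma hermD n (M N : 'M[C]_n) :
  M \is hermsymmx -> N \is hermsymmx -> M + N \is hermsymmx.
Proof.
move=> /hermsymP hM /hermsymP hN.
by apply/hermsymP; rewrite linearD /= map_mxD -hM -hN.
Qed.

Lemma hermZ n (a : R) (M : 'M[C]_n) :
  M \is hermsymmx -> a%:C *: M \is hermsymmx.
Proof.
move=> /hermsymP hM; apply/hermsymP; rewrite linearZ /= map_mxZ -hM.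
by congr (_ *: _); apply/esym/CrealP; rewrite complex_real.
Qed.

Lemma hermB n (M N : 'M[C]_n) :
  M \is hermsymmx -> N \is hermsymmx -> M - N \is hermsymmx.
Proof.
move=> hM hN; rewrite -[- N]scaleN1r.
have -> : -1 = (-1)%:C :> C by rewrite rmorphN1.
exact/hermD/hermZ.
Qed.

Lemma herm_scalar n (a : R) : ((a%:C)%:M : 'M[C]_n) \is hermsymmx.
Proof.
rewrite -scalemx1; apply: hermZ.
by apply/hermsymP; rewrite trmx1 map_mx1.
Qed.

Lemma qformD n (M N : 'M[C]_n) x : qform (M + N) x = qform M x + qform N x.
Proof. by rewrite /qform mulmxDr mulmxDl mxE. Qed.

Lemma qformN n (M : 'M[C]_n) x : qform (- M) x = - qform M x.
Proof. by rewrite /qform mulmxN mulNmx mxE. Qed.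

Lemma qformZ n a (M : 'M[C]_n) x : qform (a *: M) x = a * qform M x.
Proof. by rewrite /qform -scalemxAr -scalemxAl mxE. Qed.

Lemma psdZ n (t : R) (P : 'M[C]_n) : 0 <= t -> psd P -> psd (t%:C *: P).
Proof.
move=> t0 [hP P0]; split=> [|x]; first exact: hermZ.
by rewrite qformZ mulr_ge0 // lecR.
Qed.

Lemma diag_adj n (d : 'I_n -> R) :
  (diag_mx (\row_j (d j)%:C)) ^t* = diag_mx (\row_j (d j)%:C).
Proof.
rewrite tr_diag_mx map_diag_mx; congr diag_mx; apply/rowP => j.
by rewrite !mxE; apply/CrealP; rewrite complex_real.
Qed.

Lemma psd_conj n (S : 'M[C]_n) (d : 'I_n -> R) : S \is unitarymx ->
  (forall j, 0 <= d j) -> psd (S ^t* *m diag_mx (\row_j (d j)%:C) *m S).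
Proof.
move=> uS d0; have SS : S *m S ^t* = 1%:M by exact/unitarymxP.
split=> [|x].
  by apply/hermsymP; rewrite !trmx_mul !map_mxM diag_adj trmxCK mulmxA.
rewrite (qform_spectral (d := d) x uS) ?mulmxA ?SS ?mul1mx //.
by apply: sumr_ge0 => j _; rewrite mulr_ge0 ?exprn_ge0 // lecR.
Qed.

(** [P] and [Q] are the positive and negative parts of [B - beta], where
    [beta] is the [k]-th largest eigenvalue of [B]. *)
Lemma herm_split n (k : nat) (B : 'M[C]_n) : B \is hermsymmx ->
  (0 < k)%N -> (k < n)%N ->
  exists P Q : 'M[C]_n, [/\ psd P, psd Q,
    B = ((lambda B k.-1)%:C)%:M + P - Q &
    forall j : 'I_n, lambda P j = if (j < k)%N then lambda B j - lambda B k.-1 else 0].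
Proof.
move=> hB k0 kn; have [S uS SB] := spectral_sorted hB.
have SS : S *m S ^t* = 1%:M by exact/unitarymxP.
pose b := lambda B k.-1.
pose p (j : 'I_n) := if (j < k)%N then lambda B j - b else 0.
pose q (j : 'I_n) := if (j < k)%N then 0 else b - lambda B j.
have p0 j : 0 <= p j.
  rewrite /p; case: ltnP => // jk; rewrite subr_ge0 lambda_mono //; lia.
have q0 j : 0 <= q j.
  rewrite /q; case: ltnP => // jk; rewrite subr_ge0 lambda_mono //; lia.
exists (S ^t* *m diag_mx (\row_j (p j)%:C) *m S).
exists (S ^t* *m diag_mx (\row_j (q j)%:C) *m S).
split; [exact: psd_conj|exact: psd_conj| |].
  have eB : B = S ^t* *m (S *m B) by rewrite mulmxA (mulmx1C SS) mul1mx.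
  rewrite [LHS]eB SB mulmxA -/b -addrA -mulmxBl -mulmxBr.
  have -> : (b%:C)%:M = S ^t* *m (b%:C)%:M *m S.
    by rewrite scalar_mxC -mulmxA (mulmx1C SS) mulmx1.
  rewrite -mulmxDl -mulmxDr; congr (_ *m _ *m _).
  apply/matrixP => i j; rewrite !mxE -mulrnBl -mulrnDl; congr (_ *+ _).
  rewrite -rmorphB -rmorphD /=; congr (_%:C).
  by rewrite /p /q; case: ifP => _; rewrite ?subr0 ?sub0r ?opprB addrC subrK.
apply: (lambda_diag uS).
  by rewrite !mulmxA SS mul1mx.
move=> i j ij; rewrite -/(p i) -/(p j); move: (p0 i); rewrite /p.
case: (ltnP j k) => // jk; rewrite (leq_ltn_trans ij jk) => _.
by rewrite lerD2r lambda_mono.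
Qed.

Lemma sum_codom (V : nmodType) k n (i : 'I_k -> 'I_n) (F : 'I_n -> V) :
  injective i ->
  \sum_l F l = \sum_j F (i j) + \sum_(l | l \notin codom i) F l.
Proof.
move=> ii; rewrite (bigID (mem (codom i))) /=; congr (_ + _).
rewrite -big_uniq /=; last by rewrite map_inj_uniq ?enum_uniq.
by rewrite big_map big_enum.
Qed.

Lemma lambda_traceR n (M : 'M[C]_n) : M \is hermsymmx ->
  \sum_(j < n) lambda M j = complex.Re (\tr M).
Proof.
by move=> /lambda_trace <-; rewrite -(rmorph_sum (@real_complex R)).
Qed.

(** The counting argument of Li and Mathias: if [b] dominates [a], the growth
    of the terms indexed by [i] is at most the growth [p] of the whole sum;
    when it reaches [p], the other terms do not grow. *)
Lemma sum_codom_le k n (i : 'I_k -> 'I_n) (a b : 'I_n -> R) (c : 'I_k -> R) (p : R) :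
  injective i -> (forall j, c j <= b (i j)) -> (forall l, a l <= b l) ->
  \sum_l b l = \sum_l a l + p ->
  \sum_j c j <= \sum_j a (i j) + p /\
  (\sum_j c j = \sum_j a (i j) + p ->
     (forall j, c j = b (i j)) /\ (forall l, l \notin codom i -> b l = a l)).
Proof.
move=> ii cb ab; rewrite !(sum_codom _ ii) => E.
have h1 := ler_sum (index_enum _) (fun j (_ : xpredT j) => cb j).
have h2 := ler_sum (index_enum _) (fun l (_ : l \notin codom i) => ab l).
split=> [|e]; first by lra.
have [E1 E2] : \sum_j b (i j) = \sum_j c j /\
  \sum_(l | l \notin codom i) b l = \sum_(l | l \notin codom i) a l.
  by split; lra.
split=> [j|l il]; apply/eqP.
- rewrite eq_sym -subr_eq0; apply/eqP.
  apply: (psumr_eq0P (P := xpredT) (F := fun j => b (i j) - c j)) => // [a0 _|].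
    by rewrite subr_ge0.
  by rewrite sumrB E1 subrr.
- rewrite -subr_eq0; apply/eqP.
  apply: (psumr_eq0P (P := fun l => l \notin codom i) (F := fun l => b l - a l)) => // [a0 _|].
    by rewrite subr_ge0.
  by rewrite sumrB E2 subrr.
Qed.

(** The increase of the selected eigenvalues under [P - Q] is at most the trace
    of [P]. If equality holds, [Q] leaves the selected eigenvalues of [A + P]
    unchanged, and [P] leaves the other eigenvalues of [A] unchanged. *)
Lemma lidskii k n (i : 'I_k -> 'I_n) (A P Q : 'M[C]_n) :
  injective i -> A \is hermsymmx -> psd P -> psd Q ->
  \sum_j lambda (A + P - Q) (i j) <=
    \sum_j lambda A (i j) + \sum_(l < n) lambda P l /\
  (\sum_j lambda (A + P - Q) (i j) =
     \sum_j lambda A (i j) + \sum_(l < n) lambda P l ->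
   (forall j, lambda (A + P - Q) (i j) = lambda (A + P) (i j)) /\
   (forall l, l \notin codom i -> lambda (A + P) l = lambda A l)).
Proof.
move=> ii hA hP hQ; have hAP := hermD hA hP.1.
apply: (sum_codom_le (a := fun l : 'I_n => lambda A l)
          (b := fun l : 'I_n => lambda (A + P) l)
          (c := fun j => lambda (A + P - Q) (i j)) ii).
- move=> j; apply: (lambda_le _ (hermB hAP hQ.1) hAP) => x.
  by rewrite qformD qformN gerDl oppr_le0 hQ.2.
- by move=> l; apply: (lambda_le _ hA hAP) => x; rewrite qformD lerDl hP.2.
- apply: (etrans (lambda_traceR hAP)); rewrite linearD raddfD.
  by congr (_ + _); apply/esym; [exact: lambda_traceR hA|exact: lambda_traceR hP.1].
Qed.

(** * Generic parameters *)

(** The rank of [M + z N] is at least its value at [z0] outside the zeros of a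
    nonzero polynomial, namely a minor that does not vanish at [z0]. *)
Lemma rank_pencil_generic (F : fieldType) n (M N : 'M[F]_n) (z0 : F) :
  exists2 p : {poly F}, p != 0 &
    forall z, p.[z] != 0 -> (\rank (M + z0 *: N)%R <= \rank (M + z *: N)%R)%N.
Proof.
pose r : nat := \rank (M + z0 *: N)%R; rewrite -/r.
have [L [T LT]] : exists (L : 'M_(r, n)) (T : 'M_(n, r)),
    L *m (M + z0 *: N) *m T = 1%:M.
  exists (pid_mx r *m invmx (col_ebase (M + z0 *: N))).
  exists (invmx (row_ebase (M + z0 *: N)) *m pid_mx r).
  rewrite -{2}(mulmx_ebase (M + z0 *: N)) -/r.
  rewrite -!mulmxA mulKmx ?col_ebase_unit // mulKVmx ?row_ebase_unit //.
  have rn : (r <= n)%N by exact: rank_leq_row.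
  by rewrite -/r (@pid_mx_id F n n r r rn) (@pid_mx_id F r n r r rn) pid_mx_1.
(* [L] and [T] extract an invertible block of size [r] at the parameter [z0]. *)
pose p := \det (map_mx polyC (L *m M *m T) + 'X *: map_mx polyC (L *m N *m T)).
have pE z : p.[z] = \det (L *m (M + z *: N) *m T).
  rewrite -horner_evalE -det_map_mx; congr (\det _); apply/matrixP => a b.
  rewrite mulmxDr mulmxDl -scalemxAr -scalemxAl !mxE.
  by rewrite /= horner_evalE hornerD hornerM hornerX !hornerC.
exists p.
  by apply: contraTneq (oner_neq0 F) => p0; rewrite -(det1 F r) -LT -pE p0 horner0 eqxx.
move=> z; rewrite pE => dn0.
have u : L *m (M + z *: N) *m T \in unitmx by rewrite unitmxE unitfE.
apply: (@mulmx1_min_rank _ _ _ _ _ L (T *m invmx (L *m (M + z *: N) *m T))).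
by rewrite mulmxA mulmxV.
Qed.

Lemma exists_nonroot (p : {poly C}) : p != 0 ->
  exists2 t : R, 0 < t <= 1 & p.[t%:C] != 0.
Proof.
(* The inverses of the positive integers are more numerous than the roots. *)
move=> p0; pose f (m : nat) : C := ((m.+1%:R : R)^-1)%:C.
have finj : injective f.
  by move=> a b /complexI /invr_inj /eqP; rewrite eqr_nat => /eqP[].
have [h|] := boolP (all (root p) [seq f m | m <- iota 0 (size p)]).
  have := max_poly_roots p0 h; rewrite map_inj_uniq // iota_uniq => /(_ isT).
  by rewrite size_map size_iota ltnn.
case/allPn => _ /mapP[m _ ->] fm; exists (m.+1%:R)^-1 => //.
by rewrite invr_gt0 ltr0Sn /= invf_le1 ?ltr0Sn // ler1n.
Qed.

Lemma qform_real n (M : 'M[C]_n) x : M \is hermsymmx -> qform M x \is Num.real.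
Proof.
move=> /hermsymP hM; apply/CrealP.
have e : (x *m M *m x ^t*) ^t* = x *m M *m x ^t*.
  by rewrite !trmx_mul !map_mxM /= trmxCK -hM mulmxA.
by rewrite /qform -{2}e !mxE.
Qed.

(** At the parameter ['i] the hermitian forms of [A] and [P] are the real and
    imaginary parts of the form of the pencil, so both vanish on its kernel. *)
Lemma kermx_complex_pencil n (A P : 'M[C]_n) : A \is hermsymmx -> psd P ->
  (kermx (A + 'i *: P)%R <= kermx A :&: kermx P)%MS.
Proof.
move=> hA hP; apply/rV_subP => x /sub_kermxP; rewrite mulmxDr -scalemxAr => e.
have q0 : qform A x + 'i * qform P x = 0.
  by rewrite -qformZ -qformD /qform mulmxDr -scalemxAr e mul0mx mxE.
have xP : x *m P = 0.
  apply: (psd_ker hP).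
  have := Im_rect (qform_real x hA) (qform_real x hP.1).
  by rewrite q0 raddf0.
have xA : x *m A = 0 by rewrite -e xP scaler0 addr0.
by rewrite sub_capmx; apply/andP; split; apply/sub_kermxP.
Qed.

Lemma eigenvalue_lambda n (A : 'M[C]_n) (c : R) : A \is hermsymmx ->
  eigenvalue A c%:C -> exists j : 'I_n, c = lambda A j.
Proof.
move=> hA; rewrite eigenvalue_root_char (char_poly_eigs hA).
rewrite -(big_map (fun x : R => x%:C) xpredT (fun z => 'X - z%:P)).
rewrite root_prod_XsubC mem_map; last exact: complexI.
move=> /(nthP 0)[j]; rewrite size_eigs => jn <-.
by exists (Ordinal jn).
Qed.

(** Some [t] with [0 < t <= 1] is such that every eigenvalue [c] of [A] with an
    eigenvector in the kernel of [P] has all its [A + t P]-eigenvectors in that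
    kernel. Any [t] outside a finite set would do: the kernel of [A - c + t P]
    contains the common eigenvectors, and by [rank_pencil_generic] it is no
    larger than it is at [t = 'i], where it consists of them. *)
Lemma generic_parameter n (A P : 'M[C]_n) : A \is hermsymmx -> psd P ->
  exists2 t : R, 0 < t <= 1 & forall c : R,
    (eigenspace A c%:C :&: kermx P)%MS != 0 ->
    (eigenspace (A + t%:C *: P)%R c%:C <= kermx P)%MS.
Proof.
move=> hA hP.
have [p p0 pP] := fin_all_exists2 (fun j : 'I_n =>
  rank_pencil_generic (A - (lambda A j)%:C%:M) P 'i).
have [t t01 pt] : exists2 t : R, 0 < t <= 1 & (\prod_j p j).[t%:C] != 0.
  by apply/exists_nonroot/prodf_neq0.
exists t; [exact: t01|move=> c EP0].
have [j cj] : exists j : 'I_n, c = lambda A j.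
  apply: eigenvalue_lambda => //; apply: contraNneq EP0 => E0.
  by rewrite -submx0 -E0 capmxSl.
have ptj : (p j).[t%:C] != 0.
  by move: pt; rewrite horner_prod => /prodf_neq0; apply.
have := pP j _ ptj; rewrite -cj => rk.
have sub1 : (eigenspace A c%:C :&: kermx P <= eigenspace (A + t%:C *: P)%R c%:C)%MS.
  apply/rV_subP => x; rewrite sub_capmx => /andP[/eigenspaceP xA /sub_kermxP xP].
  by apply/eigenspaceP; rewrite mulmxDr -scalemxAr xP scaler0 addr0.
have sub2 : (kermx (A - c%:C%:M + 'i *: P)%R <= eigenspace A c%:C :&: kermx P)%MS.
  exact: kermx_complex_pencil (hermB hA (herm_scalar _ _)) hP.
have := mxrankS sub2; rewrite mxrank_ker => rk2.
have : (eigenspace (A + t%:C *: P)%R c%:C <= eigenspace A c%:C :&: kermx P)%MS.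
  rewrite -(geq_leqif (mxrank_leqif_sup sub1)); apply: leq_trans rk2.
  by rewrite mxrank_ker addrAC leq_sub2l.
by move/submx_trans; apply; apply: capmxSr.
Qed.

(** * Orthonormal families in prescribed subspaces *)

Lemma mulmx_adj0 n (x y : 'rV[C]_n) : x *m y ^t* = 0 -> y *m x ^t* = 0.
Proof.
move=> xy; have -> : y *m x ^t* = (x *m y ^t*) ^t*.
  by rewrite trmx_mul map_mxM /= trmxCK.
by rewrite xy trmx0 map_mx0.
Qed.

Lemma exists_unit_orthogonal n m (W : 'M[C]_n) (Z : 'M[C]_(m, n)) :
  (\rank Z < \rank W)%N ->
  exists x : 'rV_n, [/\ (x <= W)%MS, x *m x ^t* = 1%:M & Z *m x ^t* = 0].
Proof.
move=> lt; have rZ : \rank (Z ^t*) = \rank Z.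
  by rewrite mxrank_map mxrank_tr.
have /rowV0Pn[x xI xn0] : (W :&: kermx (Z ^t*))%MS != 0.
  rewrite -mxrank_eq0 -lt0n.
  have := mxrank_sum_cap W (kermx (Z ^t*)).
  have := rank_leq_col (W + kermx (Z ^t*))%MS.
  have := rank_leq_col Z; rewrite mxrank_ker rZ; lia.
move: xI; rewrite sub_capmx => /andP[xW /sub_kermxP xZ].
have n0 : 0 < (x *m x ^t*) 0 0 by rewrite -dotmxE dnorm_gt0.
set a := (x *m x ^t*) 0 0 in n0; pose s := sqrtC a.
have s0 : 0 < s by rewrite sqrtC_gt0.
have sC : (s^*)%R = s by apply/CrealP; rewrite realE ltW.
have adjE : (s^-1 *: x) ^t* = s^-1 *: x ^t*.
  by rewrite linearZ /= map_mxZ fmorphV /= sC.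
exists (s^-1 *: x); split; first exact: scalemx_sub.
  rewrite adjE -scalemxAl -scalemxAr scalerA [x *m _]mx11_scalar -/a.
  rewrite -(sqrtCK a) -/s scale_scalar_mx; congr (_%:M).
  by rewrite expr2 mulrA -(mulrA s^-1) mulVf ?mulr1 ?mulVf ?gt_eqF.
rewrite adjE -scalemxAr.
have -> : Z *m x ^t* = (x *m Z ^t*) ^t* by rewrite trmx_mul map_mxM /= trmxCK.
by rewrite xZ trmx0 map_mx0 scaler0.
Qed.

(** Greedy choice of orthonormal vectors [v s] in the subspaces [W s], where
    [e r s] holds whenever [W r] and [W s] are not orthogonal to each other:
    it suffices that the dimension of [W s] exceed the number of earlier
    subspaces related to it. *)
Lemma orthonormal_in_subspaces n N (W : nat -> 'M[C]_n) (e : rel nat) :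
  (forall r s, (r < s < N)%N -> ~~ e r s ->
     forall x y : 'rV_n, (x <= W r)%MS -> (y <= W s)%MS -> x *m y ^t* = 0) ->
  (forall s, (s < N)%N -> (#|[pred r : 'I_s | e r s]| < \rank (W s))%N) ->
  exists2 v : nat -> 'rV[C]_n,
    forall r s, (r < N)%N -> (s < N)%N -> v r *m (v s) ^t* = ((r == s)%:R)%:M &
    forall s, (s < N)%N -> (v s <= W s)%MS.
Proof.
elim: N => [|N IH] orth rk; first by exists (fun=> 0).
have [] := IH.
- by move=> r s /andP[rs sN]; apply: orth; rewrite rs ltnS ltnW.
- by move=> s sN; apply: rk; rewrite ltnS ltnW.
move=> v vorth vW.
pose Z : 'M_(N, n) := \matrix_r (if e r N then v r else 0).
have rZ : (\rank Z < \rank (W N))%N.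
  apply: leq_ltn_trans (rk N (ltnSn N)).
  by apply: mxrank_nonzero_rows => r /negPf /= er; rewrite rowK er.
have [x [xW x1 xZ]] := exists_unit_orthogonal rZ.
have vx r : (r < N)%N -> v r *m x ^t* = 0.
  move=> rN; have [er|ner] := boolP (e r N); last first.
    by apply: (orth r N _ ner) => //; [rewrite rN /=|exact: vW].
  have := congr1 (row (Ordinal rN)) xZ.
  by rewrite row_mul rowK /= er row0.
exists (fun s => if s == N then x else v s) => [r s|s]; last first.
  by rewrite ltnS; case: eqP => [->//|/eqP sN]; rewrite leq_eqVlt (negPf sN) => /vW.
rewrite !ltnS (leq_eqVlt r) (leq_eqVlt s).
case: (eqVneq r N) => [->|rN]; case: (eqVneq s N) => [->|sN] /=.
- by move=> _ _; rewrite x1 ?eqxx.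
- by move=> _ sN'; rewrite (mulmx_adj0 (vx _ sN')) raddf0.
- by move=> rN' _; rewrite (vx _ rN') ?(negPf rN) raddf0.
- exact: vorth.
Qed.

(** * An eigenbasis adapted to a set of indices *)

Lemma char_poly_lambda n (M : 'M[C]_n) : M \is hermsymmx ->
  char_poly M = \prod_(l < n) ('X - ((lambda M l)%:C)%:P).
Proof.
by move=> /char_poly_eigs ->; rewrite (big_nth 0) size_eigs big_mkord.
Qed.

Lemma mulmx_adjE n p q (X : 'M[C]_(p, n)) (Y : 'M[C]_(q, n)) a b :
  (X *m Y ^t*) a b = (row a X *m (row b Y) ^t*) 0 0.
Proof. by rewrite !mxE; apply: eq_bigr => l _; rewrite !mxE. Qed.

Lemma card_ord_lt (p : pred nat) (s N : nat) : (s < N)%N -> p s ->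
  (#|[pred r : 'I_s | p r]| < #|[pred r : 'I_N | p r]|)%N.
Proof.
have cE (q : nat) : #|[pred r : 'I_q | p r]| = (\sum_(0 <= r < q) p r)%N.
  by rewrite big_mkord -sum1_card big_mkcond; apply: eq_bigr => r _; rewrite inE; case: (p r).
move=> sN ps; rewrite !cE [X in (_ < X)%N](big_cat_nat _ (n := s)) ?(ltnW sN) //=.
by rewrite -[X in (X < _)%N]addn0 ltn_add2l big_ltn // ps.
Qed.

Lemma eigenvectors_ortho n (H : 'M[C]_n) (x y : 'rV[C]_n) (a b : R) :
  H \is hermsymmx -> x *m H = a%:C *: x -> y *m H = b%:C *: y -> a != b ->
  x *m y ^t* = 0.
Proof.
move=> /hermsymP hH xH yH ab.
have : a%:C *: (x *m y ^t*) = b%:C *: (x *m y ^t*).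
  rewrite scalemxAl -xH [in LHS]hH -mulmxA -map_mxM -trmx_mul yH.
  rewrite linearZ /= map_mxZ scalemxAr; congr (_ *m (_ *: _)).
  by apply/CrealP; rewrite complex_real.
move/eqP; rewrite -subr_eq0 -scalerBl scaler_eq0 subr_eq0.
by rewrite (inj_eq (@complexI R)) (negPf ab) => /eqP.
Qed.

(** The indices below [n] are split into the family [i] and its complement
    [g]. *)
Section Indices.
Variables (n k m : nat) (i : 'I_k -> 'I_n) (g : 'I_m -> 'I_n).
Hypothesis ig : perm_eq (codom i ++ codom g) (enum 'I_n).

Lemma big_indices (T : Type) (x0 : T) (op : Monoid.com_law x0) (F : 'I_n -> T) :
  \big[op/x0]_l F l = op (\big[op/x0]_j F (i j)) (\big[op/x0]_l F (g l)).
Proof. by rewrite -big_enum -(perm_big _ ig) big_cat /= !big_image. Qed.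

Lemma size_indices : (k + m)%N = n.
Proof. by have := perm_size ig; rewrite size_cat !size_codom !card_ord size_enum_ord. Qed.

Lemma indices_notin l : g l \notin codom i.
Proof.
have : uniq (codom i ++ codom g) by rewrite (perm_uniq ig) enum_uniq.
rewrite cat_uniq => /and3P[_ /hasPn h _]; apply: h.
exact: codom_f.
Qed.

(** An orthonormal eigenbasis of [H], made of rows [X] for the indices in [i]
    that are killed by [Q] and of rows [Y] for the other indices that are
    killed by [P]. Indices in [i] are served first; for the others the whole
    eigenspace lies in the kernel of [P], so its dimension is enough. *)
Lemma exists_adapted_basis (H P Q : 'M[C]_n) : H \is hermsymmx ->
  (forall c : R, (#|[pred j : 'I_k | lambda H (i j) == c]| <=
     \rank (eigenspace H c%:C :&: kermx Q)%MS)%N) ->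
  (forall l, l \notin codom i -> (eigenspace H (lambda H l)%:C <= kermx P)%MS) ->
  exists (X : 'M[C]_(k, n)) (Y : 'M[C]_(m, n)),
    [/\ X *m X ^t* = 1%:M, Y *m Y ^t* = 1%:M & X *m Y ^t* = 0] /\
    [/\ X *m Q = 0, Y *m P = 0 &
        Y *m H = diag_mx (\row_l (lambda H (g l))%:C) *m Y].
Proof.
move=> hH rI rC.
(* [lam s] is the eigenvalue wanted at the place [s]: the indices in [i] come
   first, then those in [g]; the value 0 is reached only for [s >= k + m]. *)
pose lam (s : nat) : R := if insub s : option 'I_k is Some j then lambda H (i j)
  else if insub (s - k)%N : option 'I_m is Some l then lambda H (g l) else 0.
have lamI (j : 'I_k) : lam j = lambda H (i j) by rewrite /lam valK.
have lamC (l : 'I_m) : lam (k + l)%N = lambda H (g l).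
  by rewrite /lam insubN ?ltnNge ?leq_addr // addKn valK.
pose W s : 'M[C]_n := if (s < k)%N then (eigenspace H (lam s)%:C :&: kermx Q)%MS
  else eigenspace H (lam s)%:C.
have WE s (x : 'rV[C]_n) : (x <= W s)%MS -> x *m H = (lam s)%:C *: x.
  rewrite /W; case: ifP => _; last by move/eigenspaceP.
  by rewrite sub_capmx => /andP[/eigenspaceP].
have rE (c : R) : (#|[pred l : 'I_n | lambda H l == c]| <= \rank (eigenspace H c%:C))%N.
  have p0 : psd (0 : 'M[C]_n).
    split=> [|x]; last by rewrite /qform mulmx0 mul0mx mxE.
    by apply/hermsymP; rewrite trmx0 map_mx0.
  apply: leq_trans (mxrankS (capmxSl _ (kermx 0))).
  apply: leq_trans (rank_eigenspace_cap c hH p0); apply: subset_leq_card.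
  by apply/subsetP => l; rewrite !inE addr0 andbb.
have [||v vO vW] := @orthonormal_in_subspaces n (k + m) W (fun r s => lam r == lam s).
- move=> r s _ ne x y /WE xH /WE yH.
  exact: eigenvectors_ortho hH xH yH ne.
- move=> s sN; rewrite /W; case: ifP => sk.
    apply: leq_trans (rI (lam s)).
    have := @card_ord_lt (fun r => lam r == lam s) s k sk (eqxx _).
    move/leq_trans; apply; apply: subset_leq_card; apply/subsetP => j.
    by rewrite !inE lamI.
  apply: leq_trans (rE (lam s)).
  apply: leq_trans (@card_ord_lt (fun r => lam r == lam s) s (k + m) sN (eqxx _)) _.
  rewrite -!sum1_card !(big_mkcond (fun j => j \in _)) /= big_split_ord /= big_indices /=.
  by apply: leq_add; apply: leq_sum => j _; rewrite !inE /= ?lamI ?lamC.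
exists (\matrix_(j < k) v j), (\matrix_(l < m) v (k + l)%N).
have kN (j : 'I_k) : (j < k + m)%N by rewrite ltn_addr.
have mN (l : 'I_m) : (k + l < k + m)%N by rewrite ltn_add2l.
split; split.
- by apply/matrixP => a b; rewrite mulmx_adjE !rowK vO // !mxE eqxx.
- by apply/matrixP => a b; rewrite mulmx_adjE !rowK vO // !mxE eqxx eqn_add2l.
- apply/matrixP => a b; rewrite mulmx_adjE !rowK vO // !mxE eqxx.
  by rewrite ltn_eqF // ltn_addr.
- apply/row_matrixP => j; rewrite row_mul rowK row0.
  have := vW j (kN j); rewrite /W ltn_ord sub_capmx => /andP[_].
  by move/sub_kermxP.
- apply/row_matrixP => l; rewrite row_mul rowK row0; apply/sub_kermxP.
  apply: submx_trans (rC _ (indices_notin l)).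
  by have := vW _ (mN l); rewrite /W ltnNge leq_addr lamC.
- apply/row_matrixP => l; rewrite !row_mul rowK (WE _ _ (vW _ (mN l))) lamC.
  by rewrite row_diag_mx mxE -scalemxAl -rowE rowK.
Qed.
End Indices.

(** * Reducing subspaces *)

Lemma char_poly_block_diag (F : comNzRingType) k m (a : 'M[F]_k) (d : 'M[F]_m) :
  char_poly (block_mx a 0 0 d) = char_poly a * char_poly d.
Proof.
rewrite /char_poly -(det_ublock _ 0); congr (\det _).
rewrite /char_poly_mx map_block_mx !map_mx0 scalar_mx_block opp_block_mx.
by rewrite add_block_mx !oppr0 !addr0.
Qed.

(** [X] and [Y] are orthonormal bases of two complementary orthogonal
    subspaces, and the rows of [Y] are eigenvectors of [M]. *)
Section Split.
Variables (n k m : nat) (X : 'M[C]_(k, n)) (Y : 'M[C]_(m, n)).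
Hypotheses (kmn : (k + m)%N = n) (XX : X *m X ^t* = 1%:M) (YY : Y *m Y ^t* = 1%:M)
  (XY : X *m Y ^t* = 0).

Let YX : Y *m X ^t* = 0.
Proof.
have -> : Y *m X ^t* = (X *m Y ^t*) ^t* by rewrite trmx_mul map_mxM /= trmxCK.
by rewrite XY trmx0 map_mx0.
Qed.

Let SS : col_mx X Y *m row_mx (X ^t*) (Y ^t*) = 1%:M.
Proof. by rewrite mul_col_row XX YY XY YX -scalar_mx_block. Qed.

Let SS' : row_mx (X ^t*) (Y ^t*) *m col_mx X Y = 1%:M.
Proof.
move: SS; case: n / kmn X Y => X' Y'; exact: mulmx1C.
Qed.

Let resolution : X ^t* *m X + Y ^t* *m Y = 1%:M.
Proof. by rewrite -mul_row_col SS'. Qed.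

Variables (M : 'M[C]_n) (mu : 'I_m -> R).
Hypotheses (hM : M \is hermsymmx) (YM : Y *m M = diag_mx (\row_l (mu l)%:C) *m Y).

Let XMY : X *m M *m Y ^t* = 0.
Proof.
have -> : X *m M *m Y ^t* = (Y *m M *m X ^t*) ^t*.
  by rewrite !trmx_mul !map_mxM /= trmxCK -(hermsymP _ hM) mulmxA.
by rewrite YM -mulmxA YX mulmx0 trmx0 map_mx0.
Qed.

Lemma reducing_stable : X *m M = X *m M *m X ^t* *m X.
Proof.
by rewrite -{1}(mulmx1 (X *m M)) -resolution mulmxDr !mulmxA XMY mul0mx addr0.
Qed.

Lemma reducing_char_poly :
  char_poly M = char_poly (X *m M *m X ^t*) * \prod_l ('X - ((mu l)%:C)%:P).
Proof.
rewrite -(char_poly_conj M SS SS') mul_col_mx mul_col_row XMY.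
rewrite YM -!mulmxA YX YY mulmx0 mulmx1 char_poly_block_diag mulmxA.
congr (_ * _); rewrite char_poly_trig ?diag_mx_is_trig //.
by apply: eq_bigr => j _; rewrite !mxE eqxx.
Qed.

(** Eigenvalues on the row space of [X], by cancellation of the factor of the
    characteristic polynomial that [Y] carries. *)
Lemma reducing_lambda (d : 'I_k -> R) :
  (forall a b : 'I_k, (a <= b)%N -> d b <= d a) ->
  char_poly M = \prod_j ('X - ((d j)%:C)%:P) * \prod_l ('X - ((mu l)%:C)%:P) ->
  forall j : 'I_k, lambda (X *m M *m X ^t*) j = d j.
Proof.
move=> dn; rewrite reducing_char_poly => e; apply: lambda_unique => //.
apply: mulIf e; apply: monic_neq0; exact: monic_prod_XsubC.
Qed.
End Split.

Lemma herm_adj_conj n k (X : 'M[C]_(k, n)) (M : 'M[C]_n) :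
  M \is hermsymmx -> X *m M *m X ^t* \is hermsymmx.
Proof.
move=> /hermsymP hM; apply/hermsymP.
by rewrite !trmx_mul !map_mxM /= trmxCK -hM mulmxA.
Qed.

(** * The equality case for a pencil *)

Lemma lambda_char_poly p q (M : 'M[C]_p) (N : 'M[C]_q) :
  char_poly M = char_poly N -> lambda M =1 lambda N.
Proof. by rewrite /lambda /eigs => ->. Qed.

Lemma exists_complement k n (i : 'I_k -> 'I_n) : injective i ->
  exists m (g : 'I_m -> 'I_n), perm_eq (codom i ++ codom g) (enum 'I_n).
Proof.
move=> ii; pose s := [seq l <- enum 'I_n | l \notin codom i].
exists (size s), (tnth (in_tuple s)).
have -> : codom (tnth (in_tuple s)) = s by rewrite /codom /image_mem map_tnth_enum.
apply: uniq_perm; last 1 first.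
- by move=> l; rewrite mem_cat mem_filter mem_enum !inE andbT orbN.
- rewrite cat_uniq map_inj_uniq ?enum_uniq //= filter_uniq ?enum_uniq // andbT.
  by apply/hasPn => l; rewrite mem_filter => /andP[].
- exact: enum_uniq.
Qed.

Lemma addr_shuffle (V : zmodType) (a b c d : V) : a + (b + c - d) = a + c - d + b.
Proof. by rewrite (addrC b) (addrAC c) !addrA. Qed.

Lemma addr_pencil (V : lmodType C) (a b : V) (t : R) :
  a + t%:C *: b + (1 - t)%:C *: b = a + b.
Proof. by rewrite -addrA -scalerDl -rmorphD /= subrKC scale1r. Qed.

Lemma sum_shift k (F G : 'I_k -> R) (c : R) : (forall j, F j = G j + c) ->
  \sum_j F j = \sum_j G j + c * k%:R.
Proof.
by move=> FG; rewrite (eq_bigr _ (fun j _ => FG j)) big_split /= sumr_const card_ord mulr_natr.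
Qed.

(** Real arithmetic, where [t] is a time, [u] stands for [beta], [v] for [k] and
    [w] for the sum of the [k] largest eigenvalues of [B]. *)
Lemma bound_of_shift (a b c d t u v w : R) : a = c + t * u * v -> c <= b + d ->
  d = t * (w - u * v) -> a <= b + t * w.
Proof. lra. Qed.

Lemma linear_of_bounds (a b c d t w : R) : a <= b + t * w -> d <= a + (1 - t) * w ->
  d = c -> c = b + w -> a = b + t * w.
Proof. by move=> h1 h2 h3 h4; apply/le_anti; lra. Qed.

Lemma tight_of_linear (a b c d t u v w : R) : a = b + t * w -> a = c + t * u * v ->
  d = t * (w - u * v) -> c = b + d.
Proof. lra. Qed.

Lemma big_ord_cat (V : comNzRingType) k m n (F : nat -> V) : (k + m)%N = n ->
  \prod_(l < n) F l = \prod_(j < k) F j * \prod_(l < m) F (k + l)%N.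
Proof. by case: n /; rewrite big_split_ord. Qed.

(** [B = beta + P - Q] with [P] and [Q] as in [herm_split], and a strictly
    increasing family [i] of indices; equality in the inequality is assumed
    from [eq_at1] on. *)
Section PositiveParts.
Variables (n k : nat) (A B P Q : 'M[C]_n) (i : 'I_k -> 'I_n) (beta : R).
Hypotheses (hA : A \is hermsymmx) (hP : psd P) (hQ : psd Q)
  (eB : B = beta%:C%:M + P - Q) (k_lt_n : (k < n)%N)
  (lamP : forall j : 'I_n, lambda P j = if (j < k)%N then lambda B j - beta else 0)
  (i_incr : forall a b : 'I_k, (a < b)%N -> (i a < i b)%N).

Let S := \sum_(j < k) lambda B j.

Lemma incr_inj : injective i.
Proof.
move=> a b ab; apply/val_inj; case: (ltngtP a b) => // /i_incr.
  by rewrite ab ltnn.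
by rewrite ab ltnn.
Qed.

Lemma incr_le (a b : 'I_k) : (a <= b)%N -> (i a <= i b)%N.
Proof. by rewrite leq_eqVlt => /predU1P[/val_inj ->//|/i_incr /ltnW]. Qed.

Lemma sum_lambdaP : \sum_(l < n) lambda P l = S - beta * k%:R.
Proof.
under eq_bigr do rewrite lamP.
rewrite -big_mkcond -(big_ord_widen n (fun l => lambda B l - beta)) ?(ltnW k_lt_n) //.
by rewrite sumrB sumr_const card_ord mulr_natr.
Qed.

Lemma sum_lambda_scaled (t : R) :
  \sum_(l < n) lambda (t%:C *: P) l = t * (S - beta * k%:R).
Proof.
rewrite -sum_lambdaP; apply: (etrans (lambda_traceR (hermZ t hP.1))).
by rewrite linearZ /= -(lambda_trace hP.1) -(rmorph_sum (@real_complex R)) -rmorphM.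
Qed.

(** Passing from [B] to [P - Q] shifts the eigenvalues by [t * beta]. *)
Lemma lambda_shifted (M : 'M[C]_n) (t : R) (l : 'I_n) : M \is hermsymmx ->
  lambda (M + t%:C *: B) l = lambda (M + t%:C *: P - t%:C *: Q) l + t * beta.
Proof.
move=> hM; have -> : M + t%:C *: B =
    M + t%:C *: P - t%:C *: Q + ((t * beta)%:C)%:M.
  rewrite eB scalerBr scalerDr scale_scalar_mx -rmorphM.
  exact: addr_shuffle.
exact: lambda_shift (hermB (hermD hM (hermZ t hP.1)) (hermZ t hQ.1)).
Qed.

Lemma sum_lambda_shifted (M : 'M[C]_n) (t : R) : M \is hermsymmx ->
  \sum_(j < k) lambda (M + t%:C *: B) (i j) =
  \sum_(j < k) lambda (M + t%:C *: P - t%:C *: Q) (i j) + t * beta * k%:R.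
Proof. by move=> hM; apply: sum_shift => j; exact: lambda_shifted. Qed.

Lemma lidskii_pencil (M : 'M[C]_n) (t : R) : M \is hermsymmx -> 0 <= t ->
  \sum_(j < k) lambda (M + t%:C *: B) (i j) <= \sum_(j < k) lambda M (i j) + t * S.
Proof.
move=> hM t0.
exact: bound_of_shift (sum_lambda_shifted t hM) (lidskii incr_inj hM (psdZ t0 hP) (psdZ t0 hQ)).1
  (sum_lambda_scaled t).
Qed.

Hypothesis eq_at1 :
  \sum_(j < k) lambda (A + B) (i j) = \sum_(j < k) lambda A (i j) + S.

(** Equality at time 1 forces equality at all earlier times, since the
    inequality also holds between the times [t] and 1. *)
Lemma lidskii_linear (t : R) : 0 <= t <= 1 ->
  \sum_(j < k) lambda (A + t%:C *: B) (i j) = \sum_(j < k) lambda A (i j) + t * S.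
Proof.
move=> /andP[t0 t1].
have hAt : A + t%:C *: B \is hermsymmx.
  apply/(hermD hA)/hermZ; rewrite eB.
  exact: hermB (hermD (herm_scalar _ _) hP.1) hQ.1.
have t1' : 0 <= 1 - t by rewrite subr_ge0.
have e := congr1 (fun N => \sum_(j < k) lambda N (i j)) (addr_pencil A B t).
exact: linear_of_bounds (lidskii_pencil hA t0) (lidskii_pencil hAt t1') e eq_at1.
Qed.

(** With [lidskii], equality at time [t] decomposes into equalities between
    single eigenvalues. *)
Lemma lidskii_tight (t : R) : 0 <= t <= 1 ->
  (forall j, lambda (A + t%:C *: P - t%:C *: Q) (i j) = lambda (A + t%:C *: P) (i j)) /\
  (forall l, l \notin codom i -> lambda (A + t%:C *: P) l = lambda A l).
Proof.
move=> t01; have /andP[t0 t1] := t01.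
apply: (lidskii incr_inj hA (psdZ t0 hP) (psdZ t0 hQ)).2.
exact: tight_of_linear (lidskii_linear t01) (sum_lambda_shifted t hA) (sum_lambda_scaled t).
Qed.

Lemma kermxZ (t : R) (M : 'M[C]_n) : t != 0 -> (kermx (t%:C *: M) <= kermx M)%MS.
Proof.
move=> t0; apply/rV_subP => x /sub_kermxP /eqP; rewrite -scalemxAr scaler_eq0.
by rewrite (inj_eq (@complexI R)) (negPf t0) => /eqP/sub_kermxP.
Qed.

(** At a generic time [t] of the interval the eigenvalues of [H = A + t P] with
    index in [i] are those of [H - t Q], and the others are those of [A], so
    the hypotheses of [exists_adapted_basis] hold for [H]. *)
Lemma reducing_family : exists m (g : 'I_m -> 'I_n) (X : 'M[C]_(k, n)) (Y : 'M[C]_(m, n)),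
  [/\ perm_eq (codom i ++ codom g) (enum 'I_n),
      [/\ X *m X ^t* = 1%:M, Y *m Y ^t* = 1%:M & X *m Y ^t* = 0] &
      [/\ X *m Q = 0, Y *m P = 0 &
        Y *m A = diag_mx (\row_l (lambda A (g l))%:C) *m Y]].
Proof.
have [m [g ig]] := exists_complement incr_inj.
have [t t01 gen] := generic_parameter hA hP.
have /andP[t0 t1] := t01; have t0' := ltW t0.
have tn0 : t != 0 by rewrite gt_eqF.
have [tI tC] : _ /\ _ := @lidskii_tight t (introT andP (conj t0' t1)).
pose H := A + t%:C *: P.
have hH : H \is hermsymmx by exact: hermD hA (hermZ t hP.1).
have rI (c : R) : (#|[pred j : 'I_k | lambda H (i j) == c]| <=
     \rank (eigenspace H c%:C :&: kermx Q)%MS)%N.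
  have := rank_eigenspace_cap c (hermB hH (hermZ t hQ.1)) (psdZ t0' hQ).
  rewrite subrK => h.
  rewrite -(card_image incr_inj); apply: (leq_trans (leq_trans _ h)).
    apply: subset_leq_card; apply/subsetP => l /imageP[j]; rewrite inE => /eqP lc ->.
    by rewrite inE [lambda (H - _) _]tI -/H lc eqxx.
  apply: mxrankS; apply/rV_subP => x xI.
  have xQ : x *m Q = 0.
    apply/sub_kermxP; apply: submx_trans (kermxZ Q tn0).
    exact: submx_trans xI (capmxSr _ _).
  have /eigenspaceP xE := submx_trans xI (capmxSl _ _).
  rewrite sub_capmx; apply/andP; split; last exact/sub_kermxP.
  by apply/eigenspaceP; rewrite -xE mulmxBr -scalemxAr xQ scaler0 subr0.
have rC l : l \notin codom i -> (eigenspace H (lambda H l)%:C <= kermx P)%MS.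
  move=> il; apply: gen.
  have := rank_eigenspace_cap (lambda H l) hA (psdZ t0' hP).
  have c0 : (0 < #|[pred j : 'I_n | (lambda A j == lambda H l) && (lambda H j == lambda H l)]|)%N.
    by apply/card_gt0P; exists l; rewrite inE /H tC // !eqxx.
  move=> /(leq_trans c0); rewrite lt0n mxrank_eq0; apply: contraNneq => E0.
  by rewrite -submx0 -E0; apply: capmxS (submx_refl _) (kermxZ _ tn0).
have [X [Y [XY [XQ YP YH]]]] := exists_adapted_basis ig hH rI rC.
exists m, g, X, Y; split; [exact: ig|exact: XY|split; [exact: XQ|exact: YP|]].
have YAH : Y *m A = Y *m H by rewrite mulmxDr -scalemxAr YP scaler0 addr0.
have eR : \row_l (lambda H (g l))%:C = \row_l (lambda A (g l))%:C.
  apply/rowP => l; rewrite [LHS]mxE [RHS]mxE.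
  by have -> : lambda H (g l) = lambda A (g l) := tC _ (indices_notin ig l).
exact: etrans YAH (etrans YH (congr1 (fun r => diag_mx r *m Y) eR)).
Qed.

(** The characteristic polynomial of [P], with the [k] leading factors set
    apart. *)
Lemma prod_lambdaP m : (k + m)%N = n ->
  \prod_(l < n) ('X - ((lambda P l)%:C)%:P) =
  \prod_(j < k) ('X - ((lambda B j - beta)%:C)%:P) *
  \prod_(l < m) ('X - ((0 : R)%:C)%:P).
Proof.
move=> kmn.
pose F (l : nat) := 'X - ((if (l < k)%N then lambda B l - beta else 0)%:C)%:P.
have -> : \prod_(l < n) ('X - ((lambda P l)%:C)%:P) = \prod_(l < n) F l.
  by apply: eq_bigr => l _; rewrite lamP.
rewrite (big_ord_cat F kmn); congr (_ * _); apply: eq_bigr => l _.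
  by rewrite /F ltn_ord.
by rewrite /F ltnNge leq_addr.
Qed.

Lemma herm_of_parts : B \is hermsymmx.
Proof. by rewrite eB; exact: hermB (hermD (herm_scalar _ _) hP.1) hQ.1. Qed.

(** The row space of [Z] reduces [A] and [B], carries the [k] largest
    eigenvalues of [B], and carries the eigenvalues of [A + t B] with index in
    [i] at all times of the unit interval. *)
Lemma reducing_subspace : exists Z : 'M[C]_(k, n),
  [/\ Z *m Z ^t* = 1%:M, Z *m A = Z *m A *m Z ^t* *m Z,
      Z *m B = diag_mx (\row_j (lambda B j)%:C) *m Z &
      forall (t : R) (j : 'I_k), 0 <= t <= 1 ->
        lambda (Z *m (A + t%:C *: B) *m Z ^t*) j = lambda (A + t%:C *: B) (i j)].
Proof.
have [m [g [X [Y [ig [XX YY XY] [XQ YP YA]]]]]] := reducing_family.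
have kmn := size_indices ig.
have XA := reducing_stable kmn XX YY XY hA YA.
have YP0 : Y *m P = diag_mx (\row_l (0 : R)%:C) *m Y.
  by rewrite YP; apply/esym/matrixP => a b; rewrite mul_diag_mx !mxE mul0r.
have XP := reducing_stable kmn XX YY XY hP.1 YP0.
have XB : X *m B = beta%:C *: X + X *m P.
  by rewrite eB mulmxBr mulmxDr XQ subr0 mul_mx_scalar.
have XBX : X *m B *m X ^t* = X *m P *m X ^t* + beta%:C%:M.
  by rewrite XB mulmxDl -scalemxAl XX scalemx1 addrC.
have XBs : X *m B = X *m B *m X ^t* *m X.
  by rewrite XBX mulmxDl -XP mul_scalar_mx XB addrC.
have hXPX := herm_adj_conj X hP.1.
have lamXBX (j : 'I_k) : lambda (X *m B *m X ^t*) j = lambda B j.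
  rewrite XBX lambda_shift //.
  rewrite (reducing_lambda kmn XX YY XY hP.1 YP0 (d := fun j : 'I_k => lambda B j - beta)).
  - by rewrite subrK.
  - by move=> a b ab; rewrite lerD2r lambda_mono // (ltn_trans _ k_lt_n).
  - exact: etrans (char_poly_lambda hP.1) (prod_lambdaP kmn).
have lamXMX (t : R) (j : 'I_k) : 0 <= t <= 1 ->
    lambda (X *m (A + t%:C *: B) *m X ^t*) j = lambda (A + t%:C *: B) (i j).
  move=> t01; have [tI tC] := lidskii_tight t01.
  have hM := hermD hA (hermZ t hP.1).
  rewrite (lambda_shifted _ _ hA) tI.
  have -> : X *m (A + t%:C *: B) *m X ^t* =
      X *m (A + t%:C *: P) *m X ^t* + (t * beta)%:C%:M.
    have -> : X *m (A + t%:C *: B) = X *m (A + t%:C *: P) + (t * beta)%:C *: X.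
      rewrite !mulmxDr -!scalemxAr XB scalerDr scalerA -rmorphM.
      by rewrite -addrA [in RHS](addrC (_ *: (X *m P))).
    by rewrite mulmxDl -scalemxAl XX scalemx1.
  rewrite (lambda_shift _ _ (herm_adj_conj X hM)); congr (_ + _).
  (* The rows of [Y] are eigenvectors of [A + t P] for every [t], with the
     constant eigenvalues that [lidskii_tight] provides. *)
  have YM : Y *m (A + t%:C *: P) = diag_mx (\row_l (lambda A (g l))%:C) *m Y.
    by rewrite mulmxDr -scalemxAr YP scaler0 addr0.
  have dec (a b : 'I_k) : (a <= b)%N ->
      lambda (A + t%:C *: P) (i b) <= lambda (A + t%:C *: P) (i a).
    by move=> ab; apply: lambda_mono; [exact: incr_le|exact: ltn_ord].
  have eC : \prod_l ('X - ((lambda (A + t%:C *: P) (g l))%:C)%:P) =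
            \prod_l ('X - ((lambda A (g l))%:C)%:P).
    by apply: eq_bigr => l _; rewrite (tC _ (indices_notin ig l)).
  apply: (reducing_lambda kmn XX YY XY hM YM dec).
  apply: (etrans (char_poly_lambda hM)); rewrite -eC.
  exact: (big_indices ig *%R).
(* [X] is rotated inside its row space so as to diagonalize [B] there. *)
have [T uT TX] := spectral_sorted (herm_adj_conj X herm_of_parts).
have TT : T *m T ^t* = 1%:M by exact/unitarymxP.
have TT' := mulmx1C TT.
have adjE : (T *m X) ^t* = X ^t* *m T ^t* by rewrite trmx_mul map_mxM.
have conjE M : T *m X *m M *m (X ^t* *m T ^t*) = T *m (X *m M *m X ^t*) *m T ^t*.
  by rewrite !mulmxA.
exists (T *m X); rewrite adjE; split.
- by rewrite mulmxA -(mulmxA T) XX mulmx1.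
- by rewrite conjE -(mulmxA T X A) {1}XA !mulmxA -(mulmxA _ (T ^t*) T) TT' mulmx1.
- rewrite -mulmxA {1}XBs mulmxA TX.
  rewrite -mulmxA; congr (diag_mx _ *m _); apply/rowP => j; rewrite !mxE.
  by rewrite lamXBX.
- move=> t j t01; rewrite conjE.
  rewrite -(lamXMX t j t01); apply: lambda_char_poly.
  exact: (char_poly_conj (X *m (A + t%:C *: B) *m X ^t*) TT TT').
Qed.
End PositiveParts.

(** * Matrices of restrictions *)

(** The matrix whose columns are the vectors of [x]. *)
Definition colsmx n k (x : k.-tuple 'cV[C]_n) : 'M[C]_(n, k) :=
  \matrix_(a, b) tnth x b a 0.

Lemma eq_cols n k (M N : 'M[C]_(n, k)) : (forall b, col b M = col b N) -> M = N.
Proof.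
by move=> MN; apply/matrixP => a b; have /colP/(_ a) := MN b; rewrite !mxE.
Qed.

Lemma col_mulmx n k l (M : 'M[C]_(n, k)) (N : 'M[C]_(k, l)) b :
  col b (M *m N) = M *m col b N.
Proof. by rewrite !colE mulmxA. Qed.

Lemma col_colsmx n k (x : k.-tuple 'cV[C]_n) b : col b (colsmx x) = tnth x b.
Proof. by apply/colP => a; rewrite !mxE. Qed.

Lemma colsmx_sum n k (x : k.-tuple 'cV[C]_n) (c : 'cV[C]_k) :
  colsmx x *m c = \sum_b c b 0 *: tnth x b.
Proof.
apply/colP => a; rewrite mxE summxE.
by apply: eq_bigr => b _; rewrite !mxE mulrC.
Qed.

Lemma orthonormal_colsmx n k (x : k.-tuple 'cV[C]_n) :
  Defs.orthonormal x <-> (colsmx x) ^t* *m colsmx x = 1%:M.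
Proof.
have E a b : ((colsmx x) ^t* *m colsmx x) a b = ((tnth x a) ^t* *m tnth x b) 0 0.
  by rewrite !mxE; apply: eq_bigr => l _; rewrite !mxE.
split=> [o|e a b]; first by apply/matrixP => a b; rewrite E o mxE.
by rewrite -E e mxE.
Qed.

Lemma mem_colsmx n k (x : k.-tuple 'cV[C]_n) U (v : 'cV[C]_n) : basis_of U x ->
  v \in U -> exists c, v = colsmx x *m c.
Proof.
move=> bU vU; exists (\col_b coord x b v).
rewrite colsmx_sum {1}(coord_basis bU vU).
by apply: eq_bigr => b _; rewrite mxE (tnth_nth 0).
Qed.

Lemma colsmx_mem n k (x : k.-tuple 'cV[C]_n) U c : basis_of U x ->
  colsmx x *m c \in U.
Proof.
move=> bU; rewrite colsmx_sum; apply: memv_suml => b _; apply: memvZ.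
by apply: (basis_mem bU); exact: mem_tnth.
Qed.

Lemma char_poly_trmx (F : comNzRingType) n (M : 'M[F]_n) : char_poly M^T = char_poly M.
Proof.
rewrite /char_poly -[in RHS]det_tr; congr (\det _).
by rewrite /char_poly_mx linearB /= tr_scalar_mx map_trmx.
Qed.

Lemma mulmx1C_eq (F : comNzRingType) k d (G : 'M[F]_(k, d)) (T : 'M[F]_(d, k)) :
  d = k -> G *m T = 1%:M -> T *m G = 1%:M.
Proof. by move=> dk; case: k / dk G T; exact: mulmx1C. Qed.

(** The eigenvalues of the restriction to an invariant subspace, read off in an
    orthonormal basis of it. *)
Lemma restriction_lambdaE n k (x : k.-tuple 'cV[C]_n) U (M : 'M[C]_n) :
  Defs.orthonormal x -> basis_of U x -> invariant_under M U ->
  restriction_lambda M U =1 lambda ((colsmx x) ^t* *m M *m colsmx x).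
Proof.
move=> /orthonormal_colsmx xx bU MU; set X := colsmx x in xx *.
rewrite /restriction_lambda; set e := vbasis _; set N := passmx.mxof _ _ _.
apply: lambda_char_poly; rewrite -char_poly_trmx.
have be : basis_of {:subvs_of U} e by exact: vbasisP.
pose E : 'M[C]_(n, _) := \matrix_(a, b) vsval (tnth e b) a 0.
have vE (u : 'rV_(\dim {:subvs_of U})) : vsval (passmx.vecof e u) = E *m u^T.
  rewrite /passmx.vecof linear_sum /=; apply/colP => a; rewrite summxE mxE.
  by apply: eq_bigr => b _; rewrite !mxE mulrC (tnth_nth 0).
have ME : M *m E = E *m N^T.
  apply: eq_cols => b; rewrite !col_mulmx.
  have -> : col b E = vsval (passmx.vecof e (delta_mx 0 b)).
    by rewrite vE trmx_delta -colE.
  rewrite -restrictionE // (passmx.hom_vecof e be) vE.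
  by rewrite -rowE tr_row.
(* [E] holds the reference basis of [U] in its columns; [G] and [T] are the
   matrices of the changes of basis between it and [X]. *)
have [G EG] : exists G, E = X *m G.
  have h b : exists c, col b E = X *m c.
    apply: (mem_colsmx bU); have -> : col b E = vsval (tnth e b).
      by apply/colP => a; rewrite !mxE.
    exact: subvsP.
  have [c cP] := fin_all_exists h.
  exists (\matrix_(a, b) c b a 0); apply: eq_cols => b.
  by rewrite cP col_mulmx; congr (_ *m _); apply/colP => a; rewrite !mxE.
have [T XT] : exists T, X = E *m T.
  have h b : exists u : 'rV_(\dim {:subvs_of U}), tnth x b = E *m u^T.
    have xU : tnth x b \in U by apply: (basis_mem bU); exact: mem_tnth.
    exists (passmx.rVof e (vsproj U (tnth x b))).
    by rewrite -vE (passmx.rVofK be) vsprojK.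
  have [c cP] := fin_all_exists h.
  exists (\matrix_(a, b) c b 0 a); apply: eq_cols => b.
  rewrite col_colsmx cP col_mulmx; congr (_ *m _); apply/colP => a.
  by rewrite !mxE.
have GT : G *m T = 1%:M.
  have : X ^t* *m (E *m T) = 1%:M by rewrite -XT.
  by rewrite EG !mulmxA xx mul1mx.
have TG : T *m G = 1%:M.
  apply: mulmx1C_eq GT; rewrite dimvf.
  exact: size_basis bU.
rewrite -(char_poly_conj N^T GT TG); congr char_poly.
have -> : G = X ^t* *m E by rewrite EG mulmxA xx mul1mx.
by rewrite -(mulmxA _ E) -ME !mulmxA -(mulmxA _ E T) -XT.
Qed.

Lemma invariant_pencil n (A B : 'M[C]_n) (t : R) U :
  invariant_under A U -> invariant_under B U -> invariant_under (pencil A B t) U.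
Proof.
move=> hA hB v vU; rewrite /pencil mulmxDl -scalemxAl.
by apply: memvD; [exact: hA|apply: memvZ; exact: hB].
Qed.

(** * The two directions of the equality criterion *)

Lemma col_mul_diag n k (X : 'M[C]_(n, k)) (d : 'I_k -> R) b :
  col b (X *m diag_mx (\row_j (d j)%:C)) = (d b)%:C *: col b X.
Proof. by apply/colP => a; rewrite mxE mul_mx_diag !mxE mulrC. Qed.

(** The sum of the eigenvalues of the restriction is a trace, hence affine in
    [t]; its slope is the trace of the restriction of [B]. *)
Lemma sum_restriction_lambda n k (A B : 'M[C]_n) U :
  A \is hermsymmx -> B \is hermsymmx ->
  invariant_under A U -> invariant_under B U ->
  spanned_by_top_eigenvectors k B U ->
  exists a : R, forall t : R, \sum_(j < k) restriction_lambda (pencil A B t) U j =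
    a + t * \sum_(j < k) lambda B j.
Proof.
move=> hA hB AU BU [x [ox bx ex]].
pose X := colsmx x; have xx : X ^t* *m X = 1%:M by exact/orthonormal_colsmx.
exists (complex.Re (\tr (X ^t* *m A *m X))) => t.
have eBX : B *m X = X *m diag_mx (\row_(j < k) (lambda B j)%:C).
  by apply: eq_cols => b; rewrite (col_mul_diag X (fun j => lambda B j)) col_mulmx col_colsmx ex.
have hM : X ^t* *m pencil A B t *m X \is hermsymmx.
  by have := herm_adj_conj (X ^t*) (hermD hA (hermZ t hB)); rewrite trmxCK.
rewrite (eq_bigr (fun j : 'I_k => lambda (X ^t* *m pencil A B t *m X) j)); last first.
  by move=> j _; exact: (restriction_lambdaE ox bx (invariant_pencil t AU BU)).
rewrite (lambda_traceR hM) /pencil mulmxDr mulmxDl -scalemxAr -scalemxAl.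
rewrite -(mulmxA _ B) eBX mulmxA xx mul1mx linearD linearZ /= mxtrace_diag raddfD /=.
congr (_ + _).
have -> : \sum_(j < k) (\row_(j < k) (lambda B j)%:C) 0 j = (\sum_(j < k) lambda B j)%:C.
  by rewrite (rmorph_sum (@real_complex R)); apply: eq_bigr => j _; rewrite mxE.
by rewrite -rmorphM.
Qed.

Lemma spanned_rows n k (Z : 'M[C]_(k, n)) : Z *m Z ^t* = 1%:M ->
  exists x : k.-tuple 'cV[C]_n,
    [/\ colsmx x = Z ^t*, Defs.orthonormal x & basis_of <<x>>%VS x].
Proof.
move=> ZZ; pose x := [tuple col j (Z ^t*) | j < k].
have xE : colsmx x = Z ^t* by apply/matrixP => a b; rewrite mxE tnth_mktuple mxE.
have ox : (colsmx x) ^t* *m colsmx x = 1%:M by rewrite xE trmxCK.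
suff fx : free x.
  by exists x; split; [exact: xE|exact/orthonormal_colsmx|rewrite /basis_of eqxx].
apply/freeP => c c0.
have cx : colsmx x *m (\col_b c b) = 0.
  by rewrite colsmx_sum -[RHS]c0; apply: eq_bigr => b _; rewrite mxE (tnth_nth 0).
move=> b; have : (colsmx x) ^t* *m colsmx x *m (\col_b c b) = 0.
  by rewrite -mulmxA cx mulmx0.
by rewrite ox mul1mx => /colP/(_ b); rewrite !mxE.
Qed.

Lemma stable_invariant n k (x : k.-tuple 'cV[C]_n) U (M : 'M[C]_n) (N : 'M[C]_k) :
  basis_of U x -> M *m colsmx x = colsmx x *m N -> invariant_under M U.
Proof.
move=> bU MX v /(mem_colsmx bU)[c ->].
by rewrite mulmxA MX -mulmxA; exact: colsmx_mem.
Qed.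

Section EqualityCriterion.
Variables (n k : nat) (A B : 'M[C]_n) (i : 'I_k -> 'I_n).
Hypotheses (hA : A \is hermsymmx) (hB : B \is hermsymmx).

Let S := \sum_(j < k) lambda B j.

Lemma pencil0 : pencil A B 0 = A.
Proof. by rewrite /pencil scale0r addr0. Qed.

Lemma pencil1 : pencil A B 1 = A + B.
Proof. by rewrite /pencil scale1r. Qed.

(** On each interval the sum of the selected eigenvalues has the extremal
    slope [S]; the increments add up. *)
Lemma equality_sufficient (r : nat) (U : 'I_r -> {vspace 'cV[C]_n}) (b : nat -> R) :
  (forall l : 'I_r, invariant_under A (U l) /\ invariant_under B (U l)) ->
  b 0%N = 0 -> b r = 1 -> (forall l : 'I_r, b l < b l.+1) ->
  (forall l : 'I_r, spanned_by_top_eigenvectors k B (U l)) ->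
  (forall (l : 'I_r) (j : 'I_k) (t : R), b l <= t <= b l.+1 ->
     restriction_lambda (pencil A B t) (U l) j = lambda (pencil A B t) (i j)) ->
  \sum_(j < k) lambda (A + B) (i j) = \sum_(j < k) lambda A (i j) + S.
Proof.
move=> inv b0 b1 bl top res.
pose f t := \sum_(j < k) lambda (pencil A B t) (i j).
have step (l : 'I_r) : f (b l.+1) - f (b l) = (b l.+1 - b l) * S.
  have [iA iB] := inv l.
  have [a ea] := sum_restriction_lambda hA hB iA iB (top l).
  have fE t : b l <= t <= b l.+1 -> f t = a + t * S.
    move=> tb; apply: etrans (ea t); apply: eq_bigr => j _.
    exact/esym/res.
  rewrite (fE (b l)) ?lexx ?ltW ?bl // (fE (b l.+1)) ?lexx ?ltW ?bl //.
  by rewrite opprD addrACA subrr add0r mulrBl.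
have : f 1 - f 0 = S.
  rewrite -b1 -b0 -(telescope_sumr (fun l => f (b l)) (leq0n r)) big_mkord.
  rewrite (eq_bigr _ (fun l _ => step l)).
  rewrite -mulr_suml -(big_mkord xpredT (fun l => b l.+1 - b l)).
  by rewrite (telescope_sumr b (leq0n r)) b0 b1 subr0 mul1r.
by move=> /(canRL (subrK _)); rewrite /f pencil0 pencil1 => ->; rewrite addrC.
Qed.

Hypotheses (k_gt0 : (0 < k)%N) (k_lt_n : (k < n)%N)
  (i_incr : forall a b : 'I_k, (a < b)%N -> (i a < i b)%N).

Lemma lidskii_inequality :
  \sum_(j < k) lambda (A + B) (i j) <= \sum_(j < k) lambda A (i j) + S.
Proof.
have [P [Q [hP hQ eB lamP]]] := herm_split hB k_gt0 k_lt_n.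
have := lidskii_pencil hP hQ eB k_lt_n lamP i_incr hA ler01.
by rewrite scale1r mul1r.
Qed.

(** A single subspace serves for the whole unit interval. *)
Lemma equality_necessary :
  \sum_(j < k) lambda (A + B) (i j) = \sum_(j < k) lambda A (i j) + S ->
  exists U : {vspace 'cV[C]_n},
    [/\ invariant_under A U, invariant_under B U, spanned_by_top_eigenvectors k B U &
      forall (j : 'I_k) (t : R), 0 <= t <= 1 ->
        restriction_lambda (pencil A B t) U j = lambda (pencil A B t) (i j)].
Proof.
move=> eq1; have [P [Q [hP hQ eB lamP]]] := herm_split hB k_gt0 k_lt_n.
have [Z [ZZ ZA ZB lamZ]] :=
  reducing_subspace hA hP hQ eB k_lt_n lamP i_incr eq1.
have [x [xE ox bx]] := spanned_rows ZZ.
have AX : A *m colsmx x = colsmx x *m (Z *m A *m Z ^t*).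
  rewrite xE; have := congr1 (fun M => M ^t*) ZA.
  by rewrite /= !trmx_mul !map_mxM /= trmxCK -(hermsymP _ hA) !mulmxA.
have BX : B *m colsmx x = colsmx x *m diag_mx (\row_(j < k) (lambda B j)%:C).
  rewrite xE; have := congr1 (fun M => M ^t*) ZB.
  by rewrite !trmx_mul !map_mxM /= -(hermsymP _ hB) diag_adj.
have AU := stable_invariant bx AX; have BU := stable_invariant bx BX.
exists <<x>>%VS; split; [exact: AU|exact: BU| |move=> j t t01].
  exists x; split; [exact: ox|exact: bx|move=> j].
  by have := congr1 (col j) BX; rewrite col_mul_diag col_mulmx col_colsmx.
rewrite (restriction_lambdaE ox bx (invariant_pencil t AU BU)) xE trmxCK.
exact: lamZ.
Qed.
End EqualityCriterion.

End LidskiiWielandt.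

Theorem theorem3p1 (R : realType) (n : nat) (A B : 'M[R[i]]_n)
    (hA : A \is hermsymmx) (hB : B \is hermsymmx)
    (k : nat) (k_gt0 : (0 < k)%N) (k_lt_n : (k < n)%N)
    (i : 'I_k -> 'I_n) (i_incr : forall a b : 'I_k, (a < b)%N -> (i a < i b)%N) :
  \sum_(j < k) lambda (A + B) (i j) <=
    \sum_(j < k) lambda A (i j) + \sum_(j < k) lambda B j
  /\
  (\sum_(j < k) lambda (A + B) (i j) =
     \sum_(j < k) lambda A (i j) + \sum_(j < k) lambda B j
   <->
   exists (r : nat) (U : 'I_r -> {vspace 'cV[R[i]]_n}) (b : nat -> R),
     (0 < r)%N /\
     (forall l : 'I_r, invariant_under A (U l) /\ invariant_under B (U l)) /\
     b 0%N = 0 /\ b r = 1 /\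
     (forall l : 'I_r, b l < b l.+1) /\
     (forall l : 'I_r, spanned_by_top_eigenvectors k B (U l)) /\
     (forall (l : 'I_r) (j : 'I_k) (t : R), b l <= t <= b l.+1 ->
        restriction_lambda (pencil A B t) (U l) j =
        lambda (pencil A B t) (i j))).
Proof.
split; first exact: lidskii_inequality.
split=> [eq1|[r [U [b [_ [inv [b0 [b1 [bl [top res]]]]]]]]]]; last first.
  exact: (equality_sufficient hA hB inv b0 b1 bl top res).
have [U [AU BU top res]] := equality_necessary hA hB k_gt0 k_lt_n i_incr eq1.
exists 1%N, (fun=> U), (fun l => l%:R); do 4!split=> //; split; last first.
  by split=> // l j t; rewrite (ord1 l); exact: res.
by move=> l; rewrite ltr_nat.
Qed.
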